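(* Let $\pi:E\to B$ be a fiber bundle and let $\{\Pi_t\}_{t\in[0,1]}$ be a smooth family of coupling Poisson tensors on $E$ associated with geometric data $(\Upsilon,\Gamma^t,F^t)$, where the vertical part $\Upsilon$ does not depend on $t$. Assume that there exists a smooth family of $1$-forms $Q^t\in\Omega^1(B)\otimes C^\infty(E)$ such that for every $t\in[0,1]$ and every vector field $u$ on $B$ $$\mathrm{hor}^{\Gamma^t}(u)=\mathrm{hor}^{\Gamma^0}(u)+\Upsilon^\natural dQ^t(u),\qquad F^t=F^0-\Big(\partial^{\Gamma^0}Q^t+\tfrac12\{Q^t\wedge Q^t\}_\Upsilon\Big).$$ Then $\{\Pi_t\}$ admits as infinitesimal generator the $\Gamma^t$-horizontal time-dependent vector field $X_t=X_t^i(\xi,x)\,\mathrm{hor}^{\Gamma^t}(\partial/\partial\xi^i)$ uniquely determined by $$\mathbf i_{X_t}F^t=\frac{\partial Q^t}{\partial t};$$ that is, $L_{X_t}\Pi_t+\frac{\partial \Pi_t}{\partial t}=0$.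
   Context: Everything is smooth; repeated indices are summed. $\mathbb V=\ker d\pi\subset TE$, $\mathbb V^0\subset T^*E$ its annihilator. For a bivector field $\Pi$ on $E$, $\Pi^\natural:T^*E\to TE$ is $\langle\beta,\Pi^\natural(\alpha)\rangle=\Pi(\alpha,\beta)$. An Ehresmann connection $\Gamma$ is a subbundle $\mathbb H$ with $TE=\mathbb H\oplus\mathbb V$; $\mathrm{hor}^\Gamma(u)$ is the horizontal lift of a vector field $u$ on $B$. $\Omega^k(B)\otimes C^\infty(E)$ (over $C^\infty(B)$) is the space of $k$-forms on $B$ with values in $C^\infty(E)$; for such $\Theta$, $\pi^*\Theta$ is the horizontal $k$-form on $E$ with $(\pi^*\Theta)(\mathrm{hor}^\Gamma(u_1),\dots)=\Theta(u_1,\dots)$, and $$(\partial^{\Gamma}\Theta)(u_0,\dots,u_k)=\sum_{i}(-1)^i L_{\mathrm{hor}^\Gamma(u_i)}\Theta(u_0,\dots,\hat u_i,\dots,u_k)+\sum_{i<j}(-1)^{i+j}\Theta([u_i,u_j],u_0,\dots,\hat u_i,\dots,\hat u_j,\dots,u_k).$$ A coupling Poisson tensor is a Poisson bivector field $\Pi$ such that $\mathbb H=\Pi^\natural(\mathbb V^0)$ is complementary to $\mathbb V$ everywhere; then $\mathbb H$ defines a connection $\Gamma$, $\Pi=\Pi_H+\Pi_V$ with $\Pi_H$ horizontal and $\Pi_V$ vertical, and there is a unique $F\in\Omega^2(B)\otimes C^\infty(E)$ (the coupling form), nondegenerate at each point of $E$, with $\Pi_H(\beta_1,\beta_2)=(\pi^*F)(\Pi_H^\natural\beta_1,\Pi_H^\natural\beta_2)$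 for sections $\beta_i$ of $\mathbb V^0$. $(\Pi_V,\Gamma,F)$ is the geometric data of $\Pi$; it determines $\Pi$. In local bundle coordinates $(\xi^i,x^\sigma)$ ($\xi^i$ on $B$), $\Pi=-\frac12F^{ij}\mathrm{hor}_i\wedge\mathrm{hor}_j+\Pi_V$ with $F_{ij}=F(\partial_{\xi^i},\partial_{\xi^j})$, $F^{is}F_{sj}=\delta^i_j$, $\mathrm{hor}_i=\mathrm{hor}^\Gamma(\partial_{\xi^i})$. The vertical part $\Pi_V$ is itself a Poisson tensor. For horizontal $X=X^i\mathrm{hor}_i$, $\mathbf i_XF\in\Omega^1(B)\otimes C^\infty(E)$ is defined by $\pi^*(\mathbf i_XF)=\mathbf i_X(\pi^*F)$, locally $\mathbf i_XF=X^sF_{sj}\,d\xi^j$. With $\{f,h\}_\Upsilon=\Upsilon(df,dh)$, for $Q\in\Omega^1(B)\otimes C^\infty(E)$, $\{Q\wedge Q\}_\Upsilon(u_0,u_1)=\{Q(u_0),Q(u_1)\}_\Upsilon-\{Q(u_1),Q(u_0)\}_\Upsilon$. An infinitesimal generator of $\{\Pi_t\}$ is a time-dependent vector field $Z_t$ on $E$ with $L_{Z_t}\Pi_t+\partial\Pi_t/\partial t=0$. *)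

(* Defs.v *)
From HB Require Import structures.
From mathcomp Require Import all_boot all_order all_algebra.
From mathcomp Require Import all_classical all_reals all_analysis.

Set Implicit Arguments.
Unset Strict Implicit.
Unset Printing Implicit Defensive.

Import Order.TTheory GRing.Theory Num.Theory numFieldNormedType.Exports.

Local Open Scope classical_set_scope.
Local Open Scope ring_scope.

(** * Smooth maps between subsets of normed spaces *)

Section Smooth.
Context {R : realType} {V W : normedModType R}.

Fixpoint Ck (k : nat) (U : set V) (f : V -> W) : Prop :=
  (forall x, U x -> {for x, continuous f}) /\
  match k with
  | 0%N => True
  | k'.+1 => forall v : V,
      (forall x, U x -> derivable f x v) /\ Ck k' U (fun x => 'D_v f x)
  end.

(* For open [A] this is C^oo on [A]; for sets such as [0, 1] x U it is the
   usual smoothness up to the boundary, through local smooth extensions. *)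
Definition smooth_on (A : set V) (f : V -> W) : Prop :=
  forall x, A x -> exists (U : set V) (g : V -> W),
    [/\ open U, U x, (forall k, Ck k U g) & forall y, A y -> U y -> g y = f y].

End Smooth.

(** * Smooth manifolds *)

Record chart (R : realType) (M : topologicalType) (V : normedModType R) :=
  Chart { cdom : set M; cmap : M -> V; cinv : V -> M }.

Section Charts.
Context {R : realType}.

Definition is_chart (M : topologicalType) (V : normedModType R)
    (c : chart M V) : Prop :=
  [/\ open (cdom c), open (cmap c @` cdom c),
      (forall p, cdom c p -> cinv c (cmap c p) = p),
      {within cdom c, continuous (cmap c)} &
      {within cmap c @` cdom c, continuous (cinv c)}].

Definition compatible (M : topologicalType) (V : normedModType R)
    (c c' : chart M V) : Prop :=
  smooth_on (cmap c @` (cdom c `&` cdom c')) (cmap c' \o cinv c).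

Definition prod_chart (M N : topologicalType) (V W : normedModType R)
    (c : chart M V) (d : chart N W) : chart (M * N)%type (V * W)%type :=
  Chart (cdom c `*` cdom d) (fun p => (cmap c p.1, cmap d p.2))
        (fun z => (cinv c z.1, cinv d z.2)).

Definition prod_atlas (M N : topologicalType) (V W : normedModType R)
    (A : set (chart M V)) (B : set (chart N W))
    : set (chart (M * N)%type (V * W)%type) :=
  [set e | exists c d, [/\ A c, B d & e = prod_chart c d]].

Definition smooth_map_on (M N : topologicalType) (V W : normedModType R)
    (AM : set (chart M V)) (AN : set (chart N W)) (D : set M) (f : M -> N)
    : Prop :=
  {within D, continuous f} /\
  forall c c', AM c -> AN c' ->
    smooth_on (cmap c @` (cdom c `&` D `&` f @^-1` cdom c'))
              (cmap c' \o f \o cinv c).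

End Charts.

(* [chart_at p] is an arbitrary chart around [p]; it serves only to identify
   the tangent space at [p] with R^n (see below). *)
Record manifold (R : realType) (n : nat) := Manifold {
  mcarrier :> topologicalType;
  atlas : set (chart mcarrier 'rV[R]_n);
  chart_at : mcarrier -> chart mcarrier 'rV[R]_n;
  manifold_hausdorff : hausdorff_space mcarrier;
  manifold_second_countable : @second_countable mcarrier;
  atlas_is_chart : forall c, atlas c -> is_chart c;
  atlas_compatible : forall c c', atlas c -> atlas c' -> compatible c c';
  atlas_chart_at : forall p, atlas (chart_at p);
  mem_chart_at : forall p, cdom (chart_at p) p }.

(** * Tensor calculus

   T_pM is identified with the row vectors 'rV_n through the chart
   [chart_at p], T_p^*M with the column vectors 'cV_n, the pairing being the
   matrix product.  A bivector at p is a skew matrix P, whose value on two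
   covectors is a^T *m P *m b; a 2-form at p is a skew matrix F, whose value on
   two tangent vectors is v *m F *m w^T. *)

Section Calculus.
Context {R : realType} {n : nat} {M : manifold R n}.

Section ValuedFunctions.
Context {W : normedModType R}.

Definition smooth_fun_on (D : set M) (f : M -> W) : Prop :=
  forall c, atlas c -> smooth_on (cmap c @` (cdom c `&` D)) (f \o cinv c).

Definition smooth_family_on (D : set M) (g : R -> M -> W) : Prop :=
  forall c, atlas c ->
    smooth_on (V := (R * 'rV[R]_n)%type)
      (`[0, 1] `*` (cmap c @` (cdom c `&` D)))
      (fun z => g z.1 (cinv c z.2)).

Definition tangent_fun (f : M -> W) (p : M) (v : 'rV[R]_n) : W :=
  'D_v (f \o cinv (chart_at p)) (cmap (chart_at p) p).

Definition lie_fun (u : M -> 'rV[R]_n) (f : M -> W) (p : M) : W :=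
  tangent_fun f p (u p).

End ValuedFunctions.

Definition dfun (f : M -> R) (p : M) : 'cV[R]_n :=
  \col_i tangent_fun f p (delta_mx 0 i).

Definition vector_field (u : M -> 'rV[R]_n) : Prop :=
  forall c, atlas c -> smooth_fun_on (cdom c) (lie_fun u (cmap c)).

Definition time_dependent_vector_field (X : R -> M -> 'rV[R]_n) : Prop :=
  forall c, atlas c ->
    smooth_family_on (cdom c) (fun t => lie_fun (X t) (cmap c)).

(* The components of [u, v] in the chart at [p] are the values of the
   derivation [u, v] on the coordinate functions of that chart. *)
Definition lie_bracket (u v : M -> 'rV[R]_n) (p : M) : 'rV[R]_n :=
  let x := cmap (chart_at p) in lie_fun u (lie_fun v x) p - lie_fun v (lie_fun u x) p.

Definition chart_coord (c : chart M 'rV[R]_n) (i : 'I_n) (p : M) : R := cmap c p 0 i.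

Definition bivector_at (P : 'M[R]_n) (a b : 'cV[R]_n) : R :=
  (a^T *m P *m b) 0 0.

(* <b, sharp P a> = P(a, b) *)
Definition sharp (P : 'M[R]_n) (a : 'cV[R]_n) : 'rV[R]_n := a^T *m P.

Definition bracket (P : M -> 'M[R]_n) (f g : M -> R) (p : M) : R :=
  bivector_at (P p) (dfun f p) (dfun g p).

Definition bivector_field (P : M -> 'M[R]_n) : Prop :=
  (forall p, (P p)^T = - P p) /\
  (forall c, atlas c -> forall i j,
     smooth_fun_on (cdom c) (bracket P (chart_coord c i) (chart_coord c j))).

Definition smooth_bivector_family (P : R -> M -> 'M[R]_n) : Prop :=
  (forall t, 0 <= t <= 1 -> bivector_field (P t)) /\
  (forall c, atlas c -> forall i j,
     smooth_family_on (cdom c) (fun t => bracket (P t) (chart_coord c i) (chart_coord c j))).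

Definition poisson (P : M -> 'M[R]_n) : Prop :=
  bivector_field P /\
  forall f g h : M -> R,
    smooth_fun_on setT f -> smooth_fun_on setT g -> smooth_fun_on setT h ->
    forall p, bracket P f (bracket P g h) p + bracket P g (bracket P h f) p
              + bracket P h (bracket P f g) p = 0.

(* (L_X P)(df, dg) = X(P(df, dg)) - P(d(X f), dg) - P(df, d(X g)), evaluated on
   the coordinate functions of the chart at [p] *)
Definition lie_bivector (X : M -> 'rV[R]_n) (P : M -> 'M[R]_n) (p : M)
    : 'M[R]_n :=
  let x := chart_coord (chart_at p) in
  \matrix_(i, j) (lie_fun X (bracket P (x i) (x j)) p
                  - bracket P (lie_fun X (x i)) (x j) p
                  - bracket P (x i) (lie_fun X (x j)) p).

End Calculus.

(* Time derivative on [0, 1], one-sided at the endpoints *)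
Definition time_derive {R : realType} {W : normedModType R} (g : R -> W) (t : R)
    : W :=
  lim ((s - t)^-1 *: (g s - g t) @[s --> within `[0, 1] (t^')]).

Definition infinitesimal_generator {R : realType} {n : nat} {M : manifold R n}
    (Z : R -> M -> 'rV[R]_n) (P : R -> M -> 'M[R]_n) : Prop :=
  time_dependent_vector_field Z /\
  forall t, 0 <= t <= 1 -> forall p,
    lie_bivector (Z t) (P t) p + time_derive (fun s => P s p) t = 0.

(** * Fiber bundles, connections and coupling Poisson tensors *)

(* Local trivializations (pi, tau) : pi^-1(U) -> U x F with inverse s. *)
Definition fiber_bundle {R : realType} {n m k : nat} {E : manifold R n}
    {B : manifold R m} (F : manifold R k) (pi : E -> B) : Prop :=
  smooth_map_on (@atlas R n E) (@atlas R m B) setT pi /\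
  forall b : B, exists (U : set B) (tau : E -> F) (s : B * F -> E),
    [/\ open U /\ U b,
        smooth_map_on (@atlas R n E) (prod_atlas (@atlas R m B) (@atlas R k F))
          (pi @^-1` U) (fun e => (pi e, tau e)),
        smooth_map_on (prod_atlas (@atlas R m B) (@atlas R k F)) (@atlas R n E)
          (U `*` setT) s,
        (forall e, U (pi e) -> s (pi e, tau e) = e) &
        (forall b' f, U b' -> pi (s (b', f)) = b' /\ tau (s (b', f)) = f)].

Section Bundle.
Context {R : realType} {n m : nat} {E : manifold R n} {B : manifold R m}.
Variable pi : E -> B.

Definition tangent_map (e : E) (v : 'rV[R]_n) : 'rV[R]_m :=
  tangent_fun (cmap (chart_at (pi e)) \o pi) e v.

Definition vertical (e : E) : set 'rV[R]_n := [set v | tangent_map e v = 0].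

Definition vertical_annihilator (e : E) : set 'cV[R]_n :=
  [set a | forall v, vertical e v -> v *m a = 0].

Definition complementary (H K : set 'rV[R]_n) : Prop :=
  (forall v, exists h w, [/\ H h, K w & v = h + w]) /\
  (forall v, H v -> K v -> v = 0).

(* The vector below is unique whenever [G e] is a complement of the vertical
   space; the default value 0 is then never used. *)
Definition hor (G : E -> set 'rV[R]_n) (u : B -> 'rV[R]_m) (e : E)
    : 'rV[R]_n :=
  xget 0 [set h | G e h /\ tangent_map e h = u (pi e)].

(* A k-form on B with values in C^oo(E) is given at each e by a k-form on
   T_(pi e)B: a column for k = 1, a skew matrix for k = 2. *)
Definition eval1 (Q : E -> 'cV[R]_m) (u : B -> 'rV[R]_m) (e : E) : R :=
  (u (pi e) *m Q e) 0 0.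

Definition eval2 (F : E -> 'M[R]_m) (u v : B -> 'rV[R]_m) (e : E) : R :=
  (u (pi e) *m F e *m (v (pi e))^T) 0 0.

Definition smooth_form1_family (Q : R -> E -> 'cV[R]_m) : Prop :=
  forall u : B -> 'rV[R]_m, vector_field u ->
    smooth_family_on setT (fun t => eval1 (Q t) u).

Definition form2 (F : E -> 'M[R]_m) : Prop :=
  (forall e, (F e)^T = - F e) /\
  (forall u v : B -> 'rV[R]_m, vector_field u -> vector_field v ->
     smooth_fun_on setT (eval2 F u v)).

Definition pullback2 (F : E -> 'M[R]_m) (e : E) (v w : 'rV[R]_n) : R :=
  (tangent_map e v *m F e *m (tangent_map e w)^T) 0 0.

(* i_X F, so that <pi^*(i_X F), w> = (pi^* F)(X, w) *)
Definition interior_product (X : E -> 'rV[R]_n) (F : E -> 'M[R]_m) (e : E)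
    : 'cV[R]_m :=
  (tangent_map e (X e) *m F e)^T.

(* The case k = 1 of the alternating formula for the covariant differential. *)
Definition covd1 (G : E -> set 'rV[R]_n) (Q : E -> 'cV[R]_m)
    (u0 u1 : B -> 'rV[R]_m) (e : E) : R :=
  lie_fun (hor G u0) (eval1 Q u1) e - lie_fun (hor G u1) (eval1 Q u0) e
  - eval1 Q (lie_bracket u0 u1) e.

Definition wedge_bracket (P : E -> 'M[R]_n) (Q : E -> 'cV[R]_m)
    (u0 u1 : B -> 'rV[R]_m) (e : E) : R :=
  bracket P (eval1 Q u0) (eval1 Q u1) e - bracket P (eval1 Q u1) (eval1 Q u0) e.

Definition horizontal_of (P : E -> 'M[R]_n) (e : E) : set 'rV[R]_n :=
  sharp (P e) @` vertical_annihilator e.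

Definition coupling (P : E -> 'M[R]_n) : Prop :=
  poisson P /\ forall e, complementary (horizontal_of P e) (vertical e).

(* The skew tensor [P] belongs to the second exterior power of [S]. *)
Definition bivector_in (S : set 'rV[R]_n) (P : 'M[R]_n) : Prop :=
  forall a, S (sharp P a).

(* [P] is a coupling Poisson tensor with vertical part [PV], connection [G] and
   coupling form [F]; its horizontal part is [P - PV]. *)
Definition geometric_data (P PV : E -> 'M[R]_n) (G : E -> set 'rV[R]_n)
    (F : E -> 'M[R]_m) : Prop :=
  [/\ coupling P,
      (forall e, G e = horizontal_of P e),
      bivector_field PV /\
      (forall e, bivector_in (vertical e) (PV e) /\
                 bivector_in (G e) (P e - PV e)),
      form2 F /\ (forall e, F e \in unitmx) &
      forall e (b1 b2 : 'cV[R]_n),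
        vertical_annihilator e b1 -> vertical_annihilator e b2 ->
        bivector_at (P e - PV e) b1 b2 =
        pullback2 F e (sharp (P e - PV e) b1) (sharp (P e - PV e) b2)].

End Bundle.

(* Main.v *)
Require Import Defs.
From HB Require Import structures.
From mathcomp Require Import all_boot all_order all_algebra.
From mathcomp Require Import all_classical all_reals all_analysis.
From mathcomp Require Import ring lra.
Import Order.TTheory GRing.Theory Num.Theory numFieldNormedType.Exports.
Local Open Scope classical_set_scope.
Local Open Scope ring_scope.
Set Implicit Arguments.
Unset Strict Implicit.
Unset Printing Implicit Defensive.

(** Fix a point e of E. Let A be the matrix of d pi at e, let K = A^T P_t A be
    the matrix of brackets of the base coordinates xi^i, and let
    H = K^-1 A^T P_t, whose rows are the horizontal lifts hor_i of the
    coordinate fields. The coupling condition makes K invertible, the coupling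
    form is F = - K^-1, and P_t = Ups + H^T K H (coupling_structure). So the
    equation i_X F = Q', with Q' = dQ/dt, has exactly one horizontal solution,
    X = - P_t^sharp (pi^* Q'), and this formula shows that X is as smooth in
    (t, e) as P and Q are.

    Two computations meet. On the one hand, write q_i for the components of
    Q'. Then pi^* Q' = sum_i q_i dxi^i, so X is minus the combination with
    coefficients q_i of the Hamiltonian fields of the xi^i; the Leibniz rule
    and the Jacobi identity for xi^i reduce L_X P_t to brackets of the xi^i
    and q_i with coordinates (lie_bivector_generator). On the other hand,
    differentiating the two hypotheses on Q in time gives
    hor_i' = Ups^sharp dq_i and F_ij' = - (hor_i q_j - hor_j q_i); in the
    second formula the derivative of the quadratic term of the hypothesis
    turns lifts for the initial connection into lifts for the connection at
    time t. Since K' = K F' K, the time derivative of Ups + H^T K H is a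
    polynomial in H, K, Ups and the dq_i, and it is the opposite of L_X P_t
    (generator_algebra).

    The rest is analysis. The hypotheses speak of global vector fields and
    global functions, while the computation is local: bump functions provide
    global fields that are coordinate fields near a point (coordinate_fields)
    and global functions with a given germ (smooth_extension). Smoothness
    means that all iterated directional derivatives of a local extension are
    continuous; for such functions the chain rule (through C1_differentiable)
    and the commutation of time and space derivatives (tder_space_derive) have
    to be established, up to the end points of the time interval. *)

(** * Differentiability from directional derivatives *)

Section DirectionalDerivatives.
Context {R : realType}.

(** The end points are not ordered because increments along a basis vector
    may have either sign. *)
Lemma mvt_bound (psi : R -> R) (D eps a b : R) :
  (forall s, Num.min a b <= s <= Num.max a b ->
     derivable psi s 1 /\ `|'D_1 psi s - D| <= eps) ->
  `|psi b - psi a - D * (b - a)| <= eps * `|b - a|.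
Proof.
wlog leab : a b / a <= b => [hw|h].
  move=> h; have [leab|/ltW leba] := leP a b; first exact: hw.
  have := hw b a leba; rewrite minC maxC => /(_ h).
  by rewrite -normrN opprD opprB -mulrN opprB (distrC a b).
have hs s : s \in `[a, b] -> derivable psi s 1 /\ `|'D_1 psi s - D| <= eps.
  by rewrite in_itv /= => sab; apply: h; rewrite min_l ?max_r.
have [s sab||c cab ->] := @MVT_segment R psi ('D_1 psi) a b leab.
- by apply/derivableP; have [] := hs _ (subset_itv_oo_cc sab).
- apply: derivable_within_continuous => s sab.
  by have [] := hs s sab.
- by rewrite -mulrBl normrM ler_wpM2r //; have [] := hs c cab.
Qed.

Context {V : normedModType R}.

Lemma derive_line (W : normedModType R) (f : V -> W) (x v : V) (s : R) :
  'D_1 (fun r : R => f (r *: v + x)) s = 'D_v f (s *: v + x).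
Proof.
rewrite /derive; set g1 := fun h => h^-1 *: _; set g2 := fun h => h^-1 *: _.
suff -> : g1 = g2 by [].
by apply/funext => h; rewrite /g1 /g2 /= [h%:A]mulr1 scalerDl addrA.
Qed.

Lemma derivable_line (W : normedModType R) (f : V -> W) (x v : V) (s : R) :
  derivable f (s *: v + x) v -> derivable (fun r : R => f (r *: v + x)) s 1.
Proof.
rewrite /derivable; set g1 := fun h => h^-1 *: _; set g2 := fun h => h^-1 *: _.
suff -> : g1 = g2 by [].
by apply/funext => h; rewrite /g1 /g2 /= [h%:A]mulr1 scalerDl addrA.
Qed.

(** Bounded coordinates make the coordinate forms continuous. They exist for
    R, for row vectors with the sup norm and for products of such spaces,
    which is where charts and families of functions in charts live. *)
Definition findim : Prop :=
  exists d (b : 'I_d -> V) (c : 'I_d -> V -> R),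
    [/\ forall v, v = \sum_i c i v *: b i,
        forall i, linear (c i : V -> R^o) &
        forall i v, `|c i v| <= `|v|].

Lemma differentiable_eps (W : normedModType R) (f : V -> W) (L : {linear V ->
    W})
    (x : V) : continuous L ->
  (forall e : R, 0 < e ->
     \forall h \near 0, `|f (h + x) - (f x + L h)| <= e * `|h|) ->
  differentiable f x /\ 'd f x = L :> (V -> W).
Proof.
move=> Lc hf.
have E : f \o shift x = cst (f x) + L +o_ 0 id.
  by apply/eqaddoP => e e0; have := hf e e0; apply: filterS.
split; last exact: diff_unique.
apply/diff_locallyP; split; first by rewrite (diff_unique Lc E).
by rewrite (diff_unique Lc E).
Qed.

Lemma linear_bounded_continuous (W : normedModType R) (L : V -> W) (C : R) :
  linear L -> (forall v, `|L v| <= C * `|v|) -> continuous L.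
Proof.
move=> Ll LC x; apply/cvgrPdist_le => e e0.
have C0 : 0 < `|C| + 1 by rewrite ltr_wpDl.
near=> y.
have -> : L x - L y = L (x - y).
  have -> : x - y = -1 *: y + x by rewrite scaleN1r addrC.
  by rewrite Ll scaleN1r addrC.
apply: le_trans (LC _) _; apply: (@le_trans _ _ ((`|C| + 1) * `|x - y|)).
  by rewrite ler_wpM2r // (le_trans (ler_norm _)) // lerDl.
rewrite -ler_pdivlMl //; near: y; apply: cvgr_dist_le; first exact: cvg_id.
by rewrite mulr_gt0 // invr_gt0.
Unshelve. all: by end_near. Qed.

End DirectionalDerivatives.
Arguments findim {R} V.

Section FiniteDimension.
Context {R : realType}.

Lemma findim_real : findim (R : normedModType R).
Proof.
exists 1%N, (fun=> 1), (fun=> id); split => //.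
by move=> v; rewrite big_ord1 [RHS]mulr1.
Qed.

Lemma ler_mx_norm m n (v : 'M[R]_(m, n)) i j : `|v i j| <= `|v|.
Proof.
rewrite [leRHS]/Num.Def.normr/= mx_normrE.
exact: (le_bigmax _ (fun i => `|v i.1 i.2|) (i, j)).
Qed.

Lemma findim_rV n : findim ('rV[R]_n : normedModType R).
Proof.
exists n, (fun i => delta_mx 0 i), (fun i (v : 'rV[R]_n) => v 0 i); split.
- exact: row_sum_delta.
- by move=> i a u v; rewrite !mxE.
- by move=> i v; exact: ler_mx_norm.
Qed.

Lemma findim_prod (V W : normedModType R) :
  findim V -> findim W -> findim (V * W)%type.
Proof.
move=> [d [b [c [bE cl cb]]]] [d' [b' [c' [bE' cl' cb']]]].
exists (d + d')%N,
  (fun i : 'I_(d + d') => match fintype.split i with inl j => (b j,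
    0) | inr j => (0, b' j) end),
  (fun (i : 'I_(d + d')) (v : V * W) => match fintype.split i with inl j =>
    c j v.1 | inr j => c' j v.2 end).
split.
- move=> v; rewrite big_split_ord /=.
  under eq_bigr do rewrite (unsplitK (inl _)).
  under [X in _ + X]eq_bigr do rewrite (unsplitK (inr _)).
  have s1 (r : seq 'I_d) (F : 'I_d ->
      V) : \sum_(i <- r) (F i, 0 : W) = (\sum_(i <- r) F i, 0).
    by elim/big_rec2 : _ => // i y1 y2 _ ->; congr (_, _); rewrite /= addr0.
  have s2 (r : seq 'I_d') (F : 'I_d' ->
      W) : \sum_(i <- r) (0 : V, F i) = (0, \sum_(i <- r) F i).
    by elim/big_rec2 : _ => // i y1 y2 _ ->; congr (_, _); rewrite /= addr0.
  have e1 (a : R) (u : V) : a *: (u, 0 : W) = (a *: u, 0).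
    by rewrite -[in RHS](scaler0 W a).
  have e2 (a : R) (u : W) : a *: (0 : V, u) = (0, a *: u).
    by rewrite -[in RHS](scaler0 V a).
  under eq_bigr do rewrite e1.
  under [X in _ + X]eq_bigr do rewrite e2.
  by rewrite s1 s2 -bE -bE'; case: v => v w; congr (_, _);
    rewrite /= ?addr0 ?add0r.
- by move=> i a u v; case: fintype.split => j; [exact: cl|exact: cl'].
- move=> i v; rewrite [leRHS]/Num.Def.normr /= le_max.
  by case: fintype.split => j; rewrite ?cb ?cb' ?orbT.
Qed.

(** The increment is split into steps along the directions listed in r, with
    one mean value estimate per step. Leaving the base point x' free makes
    the induction hypothesis apply at the point reached after the first
    step. *)
Lemma strictly_differentiable (V : normedModType R) (U : set V) (f : V -> R)
    (I : Type) (b : I -> V) (x : V) :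
  open U -> U x -> (forall y i, U y -> derivable f y (b i)) ->
  (forall i, {for x, continuous ('D_(b i) f)}) ->
  forall (r : seq I) (e : R), 0 < e -> exists2 de : R, 0 < de &
    forall x' (h : I -> R), `|x' - x| <= de -> (forall i, `|h i| <= de) ->
    `|f (x' + \sum_(i <- r) h i *: b i) - f x'
        - \sum_(i <- r) h i * 'D_(b i) f x| <= e * \sum_(i <- r) `|h i|.
Proof.
move=> oU Ux df cdf; elim => [|i r IH] e e0.
  by exists 1 => // x' h _ _; rewrite !big_nil addr0 !subrr normr0 mulr0.
have [d1 d10 h1] := IH e e0.
have : \forall y \near x, U y /\ `|'D_(b i) f x - 'D_(b i) f y| <= e.
  apply: filterI; first exact: open_nbhs_nbhs.
  by have /cvgrPdist_le /(_ _ e0) := cdf i.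
move=> /nbhs_closedballP [d2 h2].
(* The factor c absorbs the displacement of the base point by the first
   step. *)
pose c := 1 + `|b i|; have c0 : 0 < c by rewrite ltr_wpDr.
pose de := Num.min d1 d2%:num / c.
have de0 : 0 < de by rewrite divr_gt0 // lt_min d10 /=.
have dec : de * c = Num.min d1 d2%:num by rewrite divfK // gt_eqF.
have dec1 : de * c <= d1 by rewrite dec ge_min lexx.
have dec2 : de * c <= d2%:num by rewrite dec ge_min lexx orbT.
have ded1 : de <= d1.
  by apply: le_trans dec1; rewrite ler_peMr ?(ltW de0) // /c lerDl.
exists de => // x' h xx' hh.
have hz s : `|s| <= de -> `|s *: b i + x' - x| <= de * c.
  move=> sde; rewrite -addrA addrC (le_trans (ler_normD _ _)) //.
  by rewrite mulrDr mulr1 lerD // normrZ ler_wpM2r.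
pose x'' := x' + h i *: b i.
have H1 : `|f (x'' + \sum_(i <- r) h i *: b i) - f x''
        - \sum_(i <- r) h i * 'D_(b i) f x| <= e * \sum_(i <- r) `|h i|.
  apply: h1 => [|j]; last exact: le_trans (hh j) _.
  by apply: le_trans dec1; rewrite /x'' (addrC x'); apply: hz.
have H2 : `|f x'' - f x' - 'D_(b i) f x * h i| <= e * `|h i|.
  have := @mvt_bound R (fun s => f (s *: b i + x')) ('D_(b i) f x) e 0 (h i).
  rewrite scale0r add0r subr0 (addrC (_ *: _)); apply => s /andP[s1 s2].
  have sde : `|s| <= de.
    rewrite ler_norml (le_trans _ s1) ?(le_trans s2) //.
      by rewrite ge_max (ltW de0) (le_trans (ler_norm _)).
    rewrite le_min oppr_le0 (ltW de0) /=.
    by have := hh i; rewrite ler_norml => /andP[].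
  have [Uz Dz] : U (s *: b i + x') /\
      `|'D_(b i) f x - 'D_(b i) f (s *: b i + x')| <= e.
    apply: h2; rewrite closed_ballE //= /closed_ball_ /= distrC.
    exact: le_trans (hz _ sde) _.
  rewrite derive_line distrC; split => //.
  exact/derivable_line/df.
rewrite !big_cons mulrDr addrA -/x''.
set S1 := \sum_(j <- r) _ in H1 *; set S2 := \sum_(j <- r) _ in H1 *.
have -> : f (x'' + S1) - f x' - (h i * 'D_(b i) f x + S2) =
   (f x'' - f x' - 'D_(b i) f x * h i) + (f (x'' + S1) - f x'' - S2) by ring.
by rewrite (le_trans (ler_normD _ _)) // lerD.
Qed.

(** Ck is phrased with directional derivatives, whereas the chain rule needs
    Frechet differentiability; continuity of the derivatives along a basis
    bridges the two. *)
Lemma C1_differentiable (V : normedModType R) (U : set V) (f : V -> R) (x : V) :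
  findim V -> open U -> U x -> Ck 1 U f -> differentiable f x.
Proof.
move=> [d [b [c [bE cl cb]]]] oU Ux [_ hf].
pose L (v : V) : R := \sum_i c i v * 'D_(b i) f x.
have Ll : linear L.
  move=> a u v; rewrite /L scaler_sumr -big_split /=; apply: eq_bigr => i _.
  by rewrite (cl i a u v) mulrDl; congr (_ + _); rewrite -mulrA.
pose Lm := GRing.isLinear.Build _ _ _ _ _ Ll.
pose LL : {linear V -> R} := HB.pack L Lm.
have [||] // := @differentiable_eps R V R f LL x.
  apply: (@linear_bounded_continuous R V R L (\sum_i `|'D_(b i) f x|)) => // v.
  rewrite mulr_suml (le_trans (ler_norm_sum _ _ _)) // ler_sum // => i _.
  by rewrite normrM mulrC ler_wpM2l.
move=> e e0.
have [|||de de0 hde] := @strictly_differentiable V U f _ b x oU Ux _ _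
    (index_enum 'I_d) (e / d.+1%:R).
- by move=> y i Uy; have [/(_ y Uy)] := hf (b i).
- by move=> i; have [_ [H _]] := hf (b i); exact: H.
- by rewrite divr_gt0.
near=> h.
have hde' : `|h| <= de by near: h; apply: nbhs0_le.
have := hde x (c ^~ h); rewrite subrr normr0 (ltW de0) -bE => /(_ isT) H.
rewrite [h + x]addrC opprD addrA.
apply: le_trans (H _) _ => [i|]; first exact: le_trans (cb i h) _.
rewrite -mulrA ler_wpM2l ?(ltW e0) // ler_pdivrMl //.
apply: (@le_trans _ _ (\sum_(i < d) `|h|)); first exact: ler_sum.
by rewrite sumr_const card_ord -[leLHS]mulr_natl ler_wpM2r // ler_nat.
Unshelve. all: by end_near. Qed.

End FiniteDimension.

(** * Calculus of C^k functions *)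

Section CkCalculus.
Context {R : realType}.
Implicit Types V W : normedModType R.

Lemma linear_scaleB V W (L : V -> W) (a : R) y z : linear L ->
  L (a *: (y - z)) = a *: (L y - L z).
Proof.
move=> Ll; have L0 : L 0 = 0.
  by have := Ll (-1) 0 0; rewrite scaler0 addr0 scaleN1r addNr.
have -> : y - z = (-1) *: z + y by rewrite scaleN1r addrC.
by rewrite -[a *: _]addr0 Ll L0 addr0 Ll scaleN1r addrC.
Qed.

Lemma derive_linear_comp V W W' (L : W -> W') (f : V -> W) (x v : V) :
  linear L -> continuous L -> derivable f x v ->
  derivable (L \o f) x v /\ 'D_v (L \o f) x = L ('D_v f x).
Proof.
move=> Ll Lc df.
have H : (fun h => h^-1 *: ((L \o f \o shift x) (h *: v) - (L \o f) x)) @ 0^'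
    --> L ('D_v f x).
  have -> : (fun h => h^-1 *: ((L \o f \o shift x) (h *: v) - (L \o f) x))
     = L \o (fun h => h^-1 *: ((f \o shift x) (h *: v) - f x)).
    by apply/funext => h /=; rewrite linear_scaleB.
  exact: (cvg_comp (fun h =>
    h^-1 *: ((f \o shift x) (h *: v) - f x)) L df (Lc _)).
split; first by apply/cvg_ex; exists (L ('D_v f x)).
exact: cvg_lim H.
Qed.

(** The inner function enters only through its restriction to the line x + R
    v, which is why a single directional derivative of g is assumed. *)
Lemma derive_comp V W W' (f : W -> W') (g : V -> W) (x v : V) :
  differentiable f (g x) -> derivable g x v ->
  derivable (f \o g) x v /\ 'D_v (f \o g) x = 'd f (g x) ('D_v g x).
Proof.
move=> df dg.
have E (h : V -> W) : derivable h x v ->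
    differentiable (fun r : R => h (r *: v + x)) 0.
  by move=> dh; apply/derivable1_diffP/derivable_line; rewrite scale0r add0r.
have dg' := E _ dg.
have g0 : g (0 *: v + x) = g x by rewrite scale0r add0r.
have dfg : differentiable (fun r : R => (f \o g) (r *: v + x)) 0.
  apply: (@differentiable_comp _ _ _ _ (fun r : R => g (r *: v + x)) f) => //.
  by rewrite g0.
split.
  by apply/derivable1P/derivable1_diffP.
have := @derive_line R V _ (f \o g) x v 0.
rewrite scale0r add0r => <-; rewrite deriveE //.
have := @derive_line R V _ g x v 0.
rewrite scale0r add0r => <-; rewrite deriveE //.
rewrite (_ : (fun r : R => _) = f \o (fun r : R => g (r *: v + x))) //.
rewrite diff_comp ?g0 //.
Qed.

Lemma Ck_le V W k (U : set V) (f : V -> W) : Ck k.+1 U f -> Ck k U f.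
Proof.
elim: k f => [|k IH] f [cf df]; first by split.
by split=> // v; have [d1 d2] := df v; split => //; exact: IH.
Qed.

Lemma Ck_leq V W j k (U : set V) (f : V -> W) :
  (j <= k)%N -> Ck k U f -> Ck j U f.
Proof.
elim: k => [|k IH]; first by rewrite leqn0 => /eqP ->.
by rewrite leq_eqVlt => /orP[/eqP -> //|/IH jk /Ck_le].
Qed.

Lemma Ck_sub V W k (U U' : set V) (f : V -> W) :
  U' `<=` U -> Ck k U f -> Ck k U' f.
Proof.
move=> sU; elim: k f => [|k IH] f [cf df].
  by split=> // x /sU; exact: cf.
split=> [x /sU|v]; first exact: cf.
have [d1 d2] := df v; split; last exact: IH.
by move=> x /sU; exact: d1.
Qed.

Lemma near_open_eq V W (U : set V) (f g : V -> W) x : open U -> U x ->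
  (forall y, U y -> f y = g y) -> {near x, f =1 g}.
Proof.
by move=> oU Ux fg; near=> y; apply: fg; near: y; exact: open_nbhs_nbhs.
Unshelve. all: by end_near. Qed.

Lemma Ck_eq V W k (U : set V) (f g : V -> W) : open U ->
  (forall y, U y -> f y = g y) -> Ck k U f -> Ck k U g.
Proof.
move=> oU.
have cont (h h' : V -> W) x : (forall y, U y -> h y = h' y) -> U x ->
    {for x, continuous h} -> {for x, continuous h'}.
  move=> hh' Ux ch; have E : h @ x --> h' x by rewrite -(hh' x Ux); exact: ch.
  by apply: cvg_trans E; apply: near_eq_cvg; exact: (near_open_eq oU Ux).
elim: k f g => [|k IH] f g fg [cf df].
  by split=> // x Ux; apply: cont (cf x Ux).
split; first by move=> x Ux; apply: cont (cf x Ux).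
move=> v; have [d1 d2] := df v; split.
  move=> x Ux; apply: near_eq_derivable (d1 x Ux).
  exact: (near_open_eq oU Ux).
apply: IH d2 => y Uy; apply: near_eq_derive.
exact: (near_open_eq oU Uy).
Qed.

Lemma Ck_cst V W k (U : set V) (a : W) : Ck k U (fun=> a).
Proof.
elim: k a => [|k IH] a; first by split=> // x _; exact: cvg_cst.
split=> [x _|v]; first exact: cvg_cst.
split=> [x _|]; first exact: derivable_cst.
have -> : (fun x : V => 'D_v (fun=> a) x) = (fun=> 0); last exact: IH.
by apply/funext => x; rewrite derive_cst.
Qed.

Lemma Ck_linear_comp V W W' k (U : set V) (L : W -> W') (f : V -> W) :
  open U -> linear L -> continuous L -> Ck k U f -> Ck k U (L \o f).
Proof.
move=> oU Ll Lc; elim: k f => [|k IH] f [cf df].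
  by split=> // x /cf; move=> cfx; apply: continuous_comp cfx (Lc _).
split=> [x /cf cfx|v]; first exact: continuous_comp cfx (Lc _).
have [d1 d2] := df v; split.
  by move=> x Ux; have [] := derive_linear_comp Ll Lc (d1 x Ux).
apply: Ck_eq (IH _ d2) => // y Uy.
by have [_ ->] := derive_linear_comp Ll Lc (d1 y Uy).
Qed.

Lemma Ck_id V k (U : set V) : Ck k U (id : V -> V).
Proof.
case: k => [|k]; first by split=> // x _; exact: cvg_id.
split=> [x _|v]; first exact: cvg_id.
split=> [x _|]; first exact: derivable_id.
have -> : (fun x : V => 'D_v (id : V -> V) x) = (fun=> v); last exact: Ck_cst.
by apply/funext => x; rewrite derive_id.
Qed.

Lemma CkD V W k (U : set V) (f g : V -> W) : open U ->
  Ck k U f -> Ck k U g -> Ck k U (fun x => f x + g x).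
Proof.
move=> oU; elim: k f g => [|k IH] f g [cf df] [cg dg].
  by split=> // x Ux; apply: cvgD; [exact: cf|exact: cg].
split=> [x Ux|v]; first by apply: cvgD; [exact: cf|exact: cg].
have [f1 f2] := df v; have [g1 g2] := dg v; split.
  by move=> x Ux; apply: (derivableD (f1 x Ux) (g1 x Ux)).
apply: Ck_eq (IH _ _ f2 g2) => // y Uy.
exact: (esym (deriveD (f1 y Uy) (g1 y Uy))).
Qed.

Lemma CkM V k (U : set V) (f g : V -> R) : open U ->
  Ck k U f -> Ck k U g -> Ck k U (fun x => f x * g x).
Proof.
move=> oU; elim: k f g => [|k IH] f g [cf df] [cg dg].
  by split=> // x Ux; apply: cvgM; [exact: cf|exact: cg].
split=> [x Ux|v]; first by apply: cvgM; [exact: cf|exact: cg].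
have [f1 f2] := df v; have [g1 g2] := dg v; split.
  by move=> x Ux; apply: (derivableM (f1 x Ux) (g1 x Ux)).
have H : Ck k U (fun x => f x * 'D_v g x + g x * 'D_v f x).
  apply: CkD => //.
    by apply: IH => //; apply: Ck_le; split.
  by apply: IH => //; apply: Ck_le; split.
apply: Ck_eq H => // y Uy.
exact: (esym (deriveM (f1 y Uy) (g1 y Uy))).
Qed.

Lemma CkV V k (U : set V) (f : V -> R) : open U -> (forall x, U x ->
    f x != 0) ->
  Ck k U f -> Ck k U (fun x => (f x)^-1).
Proof.
move=> oU f0; elim: k => [|k IH] [cf df].
  by split=> // x Ux; apply: cvgV; [exact: f0|exact: cf].
split=> [x Ux|v]; first by apply: cvgV; [exact: f0|exact: cf].
have [f1 f2] := df v; split.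
  by move=> x Ux; apply: derivableV; [exact: f0|exact: f1].
have If : Ck k U (fun x => (f x)^-1) by apply: IH; apply: Ck_le; split.
have H : Ck k U (fun x => -1 * ((f x)^-1 * (f x)^-1 * 'D_v f x)).
  by do 3?[apply: CkM => //]; exact: Ck_cst.
apply: Ck_eq H => // y Uy.
rewrite deriveV; [|exact: f0|exact: f1].
by rewrite mulN1r -invfM -expr2 scaleNr.
Qed.

(** The derivative of f o g along v is the sum over a basis of c_i (D_v g)
    times (D_(b_i) f) o g, to which the induction hypothesis applies. *)
Lemma Ck_comp V V' k (U : set V) (U' : set V') (f : V' -> R) (g : V -> V') :
  findim V' -> open U -> open U' -> (forall x, U x -> U' (g x)) ->
  Ck k U' f -> Ck k U g -> Ck k U (f \o g).
Proof.
move=> fV' oU oU' gU; elim: k f => [|k IH] f [cf df] Cg; have [cg dg] := Cg.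
  by split=> // x Ux; apply: continuous_comp; [exact: cg|exact/cf/gU].
have C1f : Ck 1 U' f by apply: (@Ck_leq _ _ 1 k.+1) => //; split.
have dif x : U x -> differentiable f (g x).
  by move=> Ux; exact: (C1_differentiable fV' oU' (gU _ Ux)).
split=> [x Ux|v]; first by apply: continuous_comp; [exact: cg|exact/cf/gU].
have [g1 g2] := dg v; split.
  by move=> x Ux; have [] := derive_comp (dif _ Ux) (g1 _ Ux).
have [d [b [c [bE cl cb]]]] := fV'.
have cc i : continuous (c i : V' -> R).
  apply: (@linear_bounded_continuous R V' R (c i) 1); first exact: cl.
  by move=> w; rewrite mul1r.
have H (r : seq 'I_d) :
    Ck k U (fun x => \sum_(i <- r) c i ('D_v g x) * 'D_(b i) f (g x)).
  elim: r => [|i r IHr].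
    apply: Ck_eq (@Ck_cst _ _ k U (0 : R)) => // y _.
    by rewrite big_nil.
  have Hi : Ck k U (fun x => c i ('D_v g x) * 'D_(b i) f (g x)).
    apply: CkM => //.
      exact: (@Ck_linear_comp V V' R k U (c i) ('D_v g) oU (cl i) (cc i) g2).
    apply: (IH ('D_(b i) f)); last exact: Ck_le.
    by have [] := df (b i).
  apply: Ck_eq (CkD oU Hi IHr) => // y _.
  by rewrite big_cons.
apply: Ck_eq (H (index_enum 'I_d)) => // y Uy.
have [_ ->] := derive_comp (dif _ Uy) (g1 _ Uy).
rewrite [in RHS](bE ('D_v g y)) linear_sum; apply: eq_bigr => i _.
by rewrite linearZ -deriveE //; exact: dif.
Qed.

(** D stands for a second difference of step s, which both mixed derivatives
    approximate. *)
Lemma quadratic_gap (D d1 d2 e s : R) : 0 < s ->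
  `|D - d2 * s * s| <= e / 2 * s * s -> `|D - d1 * s * s| <= e / 2 * s * s ->
  `|d1 - d2| <= e.
Proof.
move=> s0 H1 H2; have ss0 : 0 < s * s by rewrite mulr_gt0.
rewrite -(ler_pM2r ss0).
have -> : `|d1 - d2| * (s * s) = `|(D - d2 * s * s) - (D - d1 * s * s)|.
  by rewrite -[in LHS](gtr0_norm ss0) -normrM; congr `|_|; ring.
rewrite (le_trans (ler_normB _ _)) //.
have -> : e * (s * s) = e / 2 * s * s + e / 2 * s * s by field.
exact: lerD.
Qed.

(** The second difference of f over the parallelogram with sides s u and s v
    is s^2 times either mixed derivative, up to o(s^2). The inner estimate
    key applies the mean value inequality twice, first along a and then
    along b. *)
Lemma schwarz V (U : set V) (f : V -> R) (x u v : V) : open U -> U x ->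
  Ck 2 U f -> 'D_u ('D_v f) x = 'D_v ('D_u f) x.
Proof.
move=> oU Ux Cf.
have key a b (e : R) : 0 < e -> \forall s \near (0 : R)^'+,
    `|f (s *: a + (s *: b + x)) - f (s *: a + x) - f (s *: b + x) + f x
      - 'D_b ('D_a f) x * s * s| <= e * s * s.
  move=> e0.
  have [cf df] := Cf; have [da [cda dda]] := df a.
  have [dba [cdba _]] := dda b.
  have : \forall y \near x, U y /\ `|'D_b ('D_a f) x - 'D_b ('D_a f) y| <= e.
    apply: filterI; first exact: open_nbhs_nbhs.
    by have /cvgrPdist_le /(_ _ e0) := cdba x Ux.
  move=> /nbhs_closedballP [d hd].
  have hz s1 s2 (s : R) : 0 <= s1 <= s -> 0 <= s2 <= s ->
      s * (`|a| + `|b|) <= d%:num ->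
      U (s2 *: b + (s1 *: a + x)) /\
      `|'D_b ('D_a f) x - 'D_b ('D_a f) (s2 *: b + (s1 *: a + x))| <= e.
    move=> /andP[h1 h1'] /andP[h2 h2'] hs.
    apply: hd; rewrite closed_ballE //= /closed_ball_ /= distrC.
    rewrite !addrA addrK (le_trans (ler_normD _ _)) //.
    apply: le_trans hs; rewrite mulrDr addrC !normrZ.
    by rewrite !ger0_norm // lerD // ler_wpM2r.
  near=> s.
  have s0 : 0 < s by near: s; exact: nbhs_right_gt.
  have hs : s * (`|a| + `|b|) <= d%:num.
    have c0 : 0 < `|a| + `|b| + 1 by rewrite ltr_wpDl // addr_ge0.
    apply: (@le_trans _ _ (s * (`|a| + `|b| + 1))).
      by rewrite ler_wpM2l ?lerDl // ltW.
    rewrite -ler_pdivlMr //; near: s; apply: nbhs_right_le.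
    by rewrite divr_gt0.
  have mm : forall r, Num.min 0 s <= r <= Num.max 0 s -> 0 <= r <= s.
    by move=> r; rewrite min_l ?max_r // ltW.
  have ss : 0 <= s <= s by rewrite lexx ltW.
  have s00 : 0 <= (0 : R) <= s by rewrite lexx ltW.
  have := @mvt_bound R (fun r => f (r *: a + (s *: b + x)) - f (r *: a + x))
    ('D_b ('D_a f) x * s) (e * s) 0 s.
  rewrite !scale0r !add0r !subr0 (gtr0_norm s0) => H.
  rewrite (_ : f (s *: a + (s *: b + x)) - f (s *: a + x) - f (s *: b + x) + f x
     = f (s *: a + (s *: b + x)) - f (s *: a + x) - (f (s *: b + x) - f x));
       last first.
    by ring.
  apply: H => r /mm r0s.
  have d1 : derivable (fun r : R => f (r *: a + (s *: b + x))) r 1.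
    by apply/derivable_line/da; have [] := hz r s s r0s ss hs; rewrite addrCA.
  have d2 : derivable (fun r : R => f (r *: a + x)) r 1.
    apply/derivable_line/da.
    by have [] := hz r 0 s r0s s00 hs; rewrite scale0r add0r.
  split; first exact: (derivableB d1 d2).
  rewrite (deriveB d1 d2) !derive_line.
  have := @mvt_bound R (fun q => 'D_a f (q *: b + (r *: a + x)))
    ('D_b ('D_a f) x) e 0 s.
  rewrite !scale0r !add0r !subr0 (gtr0_norm s0) (addrCA (s *: b)); apply.
  move=> q /mm q0s; have [Uz Dz] := hz r q s r0s q0s hs.
  have := derive_line ('D_a f) (r *: a + x) b q => /= ->.
  rewrite distrC; split; last exact: Dz.
  exact: (@derivable_line R V _ ('D_a f) (r *: a + x) b q (dba _ Uz)).
apply/eqP; rewrite -subr_eq0 -normr_le0; apply/ler_addgt0Pl => e e0.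
rewrite addr0.
have e20 : 0 < e / 2 by rewrite divr_gt0.
have [s [s0 [H1 H2]]] := @filter_ex _ _ _ _
  (filterI (nbhs_right_gt (0 : R)) (filterI (key u v _ e20) (key v u _ e20))).
rewrite (addrCA (s *: v)) (addrAC _ (- f (s *: v + x))) in H2.
exact: quadratic_gap H1 H2.
Unshelve. all: by end_near. Qed.

End CkCalculus.

(** * Germs of smooth functions *)

Section Germs.
Context {R : realType}.
Implicit Types V W : normedModType R.

(** The difference quotients of f o L and of f coincide. The maps y |-> (t,
    y), s |-> (s, y) and the projections of a product are of this kind. *)
Lemma Ck_affine V V' W k (U : set V') (U' : set V) (f : V' -> W)
    (L l : V -> V') :
  continuous L -> (forall h v x, L (h *: v + x) = h *: l v + L x) ->
  (forall x, U' x -> U (L x)) -> Ck k U f -> Ck k U' (f \o L).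
Proof.
move=> Lc LE LU; elim: k f => [|k IH] f [cf df].
  by split=> // x /LU /cf cfx; apply: continuous_comp cfx; exact: Lc.
split=> [x /LU /cf cfx|v]; first by apply: continuous_comp cfx; exact: Lc.
have [d1 d2] := df (l v); split.
  move=> x /LU /d1; rewrite /derivable.
  set g1 := fun h => h^-1 *: _; set g2 := fun h => h^-1 *: _.
  suff -> : g1 = g2 by [].
  by apply/funext => h; rewrite /g1 /g2 /= LE.
have := IH _ d2; congr (Ck k U' _); apply/funext => x /=.
rewrite /derive; set g1 := fun h => h^-1 *: _; set g2 := fun h => h^-1 *: _.
suff -> : g1 = g2 by [].
by apply/funext => h; rewrite /g1 /g2 /= LE.
Qed.

Lemma derive_affine V V' W (f : V' -> W) (L l : V -> V') (v x : V) :
  (forall h v x, L (h *: v + x) = h *: l v + L x) ->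
  'D_v (f \o L) x = 'D_(l v) f (L x).
Proof.
move=> LE; rewrite /derive.
set g1 := fun h => h^-1 *: _; set g2 := fun h => h^-1 *: _.
suff -> : g1 = g2 by [].
by apply/funext => h; rewrite /g1 /g2 /= LE.
Qed.

(** One point of smooth_on: closure properties of smoothness are proved for
    these germs and hold a fortiori on sets. *)
Definition smooth_germ V W (A : set V) (f : V -> W) (x : V) : Prop :=
  exists (U : set V) (g : V -> W),
    [/\ open U, U x, (forall k, Ck k U g) & forall y, A y -> U y -> g y = f y].

Lemma smooth_germ_near V W (A A' : set V) (f f' : V -> W) x :
  (\forall y \near x, A' y -> A y /\ f y = f' y) ->
  smooth_germ A f x -> smooth_germ A' f' x.
Proof.
move=> h [U [g [oU Ux sg gf]]].
exists (U `&` [set y | A' y -> A y /\ f y = f' y]°), g; split.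
- by apply: openI => //; exact: open_interior.
- by split => //; exact: h.
- by move=> k; apply: Ck_sub (sg k) => y [].
- move=> y A'y [Uy /interior_subset] /(_ A'y) [Ay <-].
  exact: gf.
Qed.

Lemma smooth_germ_eq V W (A A' : set V) (f f' : V -> W) x :
  (forall y, A' y -> A y /\ f y = f' y) -> smooth_germ A f x ->
    smooth_germ A' f' x.
Proof. by move=> h; apply: smooth_germ_near; apply: nearW. Qed.

Lemma smooth_germ_nbhs V W (A : set V) (f : V -> W) x :
  smooth_germ A f x -> \forall y \near x, smooth_germ A f y.
Proof.
move=> [U [g [oU Ux sg gf]]]; near=> y; exists U, g; split => //.
by near: y; exact: open_nbhs_nbhs.
Unshelve. all: by end_near. Qed.

Lemma smooth_germ_cst V W (A : set V) (a : W) x : smooth_germ A (fun=> a) x.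
Proof.
by exists setT, (fun=> a); split => // [|k]; [exact: openT|exact: Ck_cst].
Qed.

Lemma smooth_germ_op2 V W1 W2 W3 (op : W1 -> W2 -> W3) (A : set V) f g x :
  (forall k U f g, open U -> Ck k U f -> Ck k U g ->
     Ck k U (fun x : V => op (f x) (g x))) ->
  smooth_germ A f x -> smooth_germ A g x ->
    smooth_germ A (fun x => op (f x) (g x)) x.
Proof.
move=> H [U [f' [oU Ux sf ff]]] [U' [g' [oU' U'x sg gg]]].
exists (U `&` U'), (fun x => op (f' x) (g' x)); split => //.
- exact: openI.
- move=> k; apply: H; first exact: openI.
    by apply: Ck_sub (sf k) => y [].
  by apply: Ck_sub (sg k) => y [].
- by move=> y Ay [Uy U'y]; rewrite ff // gg.
Qed.

Lemma smooth_germD V W (A : set V) (f g : V -> W) x :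
  smooth_germ A f x -> smooth_germ A g x ->
    smooth_germ A (fun x => f x + g x) x.
Proof. by apply: smooth_germ_op2 => k U f' g'; exact: CkD. Qed.

Lemma smooth_germM V (A : set V) (f g : V -> R) x :
  smooth_germ A f x -> smooth_germ A g x ->
    smooth_germ A (fun x => f x * g x) x.
Proof. by apply: smooth_germ_op2 => k U f' g'; exact: CkM. Qed.

Lemma smooth_germ_sum V W (A : set V) I (r : seq I) (f : I -> V -> W) x :
  (forall i, smooth_germ A (f i) x) ->
    smooth_germ A (fun x => \sum_(i <- r) f i x) x.
Proof.
move=> h; elim: r => [|i r IH].
  under eq_fun do rewrite big_nil; exact: smooth_germ_cst.
under eq_fun do rewrite big_cons.
by apply: smooth_germD.
Qed.

Lemma smooth_germ_linear_comp V W W' (A : set V) (L : W -> W') (f : V -> W) x :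
  linear L -> continuous L -> smooth_germ A f x -> smooth_germ A (L \o f) x.
Proof.
move=> Ll Lc [U [g [oU Ux sg gf]]]; exists U, (L \o g); split => //.
  by move=> k; exact: Ck_linear_comp.
by move=> y Ay Uy /=; rewrite gf.
Qed.

Lemma smooth_germ_affine V V' W (A : set V') (A' : set V) (f : V' -> W)
    (L l : V -> V') x :
  continuous L -> (forall h v x, L (h *: v + x) = h *: l v + L x) ->
  (forall y, A' y -> A (L y)) ->
  smooth_germ A f (L x) -> smooth_germ A' (f \o L) x.
Proof.
move=> Lc LE LA [U [g [oU Ux sg gf]]].
exists (L @^-1` U), (g \o L); split => //.
- by apply: open_comp => // y _; exact: Lc.
- by move=> k; apply: Ck_affine (sg k).
- by move=> y A'y Uy; exact: gf (LA _ A'y) Uy.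
Qed.

Lemma smooth_germ_comp V V' (A : set V) (A' : set V') (f : V' -> R) (g : V ->
    V') x :
  findim V' -> (forall y, A y -> A' (g y)) -> A x ->
  smooth_germ A' f (g x) -> smooth_germ A g x -> smooth_germ A (f \o g) x.
Proof.
move=> fV' gA Ax [U' [f' [oU' U'x sf ff]]] [U [g' [oU Ux sg gg]]].
have cg y : U y -> {for y, continuous g'} by have [+ _] := sg 0%N; apply.
have oUU : open (U `&` g' @^-1` U').
  rewrite openE => y [Uy U'y]; rewrite /interior.
  apply: filterI; first exact: open_nbhs_nbhs.
  by apply: (cg _ Uy); exact: open_nbhs_nbhs.
exists (U `&` g' @^-1` U'), (f' \o g'); split => //.
- by split => //=; rewrite gg.
- move=> k; apply: (@Ck_comp R V V' k _ U') => //; first by move=> y [].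
  by apply: Ck_sub (sg k) => y [].
- move=> y Ay [Uy U'y] /=; rewrite /= gg // in U'y *.
  by apply: ff => //; exact: gA.
Qed.

Lemma smooth_germ_open V W (A : set V) (f : V -> W) x : open A -> A x ->
  smooth_germ A f x -> exists U, [/\ open U, U x & forall k, Ck k U f].
Proof.
move=> oA Ax [U [g [oU Ux sg gf]]]; exists (A `&` U); split => //.
  exact: openI.
move=> k; apply: (Ck_eq (f := g)); first exact: openI.
  by move=> y [Ay Uy]; exact: gf.
by apply: Ck_sub (sg k) => y [].
Qed.

Lemma smooth_germ_rV V n (A : set V) (f : V -> 'rV[R]_n) x :
  (forall i, smooth_germ A (fun y => f y 0 i) x) -> smooth_germ A f x.
Proof.
move=> h.
have : smooth_germ A (fun y => \sum_i f y 0 i *: (delta_mx 0 i : 'rV[R]_n)) x.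
  apply: smooth_germ_sum => i.
  apply: (@smooth_germ_linear_comp V R 'rV[R]_n A
    (fun r : R => r *: delta_mx 0 i) (fun y => f y 0 i) x) => //.
    by move=> a u v; rewrite scalerDl scalerA.
  exact: scalel_continuous.
by apply: smooth_germ_eq => y; split=> //; rewrite -row_sum_delta.
Qed.

Lemma smooth_germ_coord V m n (A : set V) (f : V -> 'M[R]_(m, n)) x i j :
  smooth_germ A f x -> smooth_germ A (fun y => f y i j) x.
Proof.
apply: (@smooth_germ_linear_comp V 'M[R]_(m, n) R A (fun v => v i j) f x).
  by move=> a u v; rewrite !mxE.
exact: coord_continuous.
Qed.

Lemma smooth_germ_differentiable V (A : set V) (f : V -> R) x : findim V ->
  open A -> A x -> smooth_germ A f x -> differentiable f x.
Proof.
move=> fV oA Ax /(smooth_germ_open oA Ax) [U [oU Ux sf]].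
exact: C1_differentiable (sf 1%N).
Qed.

Lemma differentiable_rV V n (f : V -> 'rV[R]_n) x :
  (forall i, differentiable (fun y => f y 0 i) x) -> differentiable f x.
Proof.
move=> h.
have -> : f = \sum_i (fun y => f y 0 i *: (delta_mx 0 i : 'rV[R]_n)).
  by apply/funext => y; rewrite fct_sumE -row_sum_delta.
by apply: differentiable_sum => i; exact: differentiableZl.
Qed.

End Germs.

(** * Time derivatives on [0, 1] *)

Section TimeDerivative.
Context {R : realType}.
Implicit Types V W : normedModType R.

(** Relational counterpart of time_derive: it carries the existence of the
    limit, which the total operator hides. *)
Definition is_time_derive W (g : R -> W) (t : R) (l : W) : Prop :=
  (s - t)^-1 *: (g s - g t) @[s --> within `[0, 1] (t^')] --> l.

Global Instance unit_time_filter (t : R) : Filter (within `[0, 1] (t^')).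
Proof. exact: within_filter. Qed.

Lemma unit_time_proper (t : R) : 0 <= t <= 1 ->
  ProperFilter (within `[0, 1] (t^')).
Proof.
move=> /andP[t0 t1]; apply: Build_ProperFilter_ex => P.
move=> /nbhs_ballP[e /= e0 He].
pose d := Num.min (e / 2) (1 / 2).
have d0 : 0 < d by rewrite lt_min !divr_gt0.
have de : d < e by rewrite gt_min ltr_pdivrMr // ltr_pMr // ltr1n.
have d12 : d <= 1 / 2 by rewrite ge_min lexx orbT.
(* Stepping away from the nearer end point by at most 1/2 stays in [0, 1]. *)
pose s := if t <= 1 / 2 then t + d else t - d.
have [s0 s1] : 0 <= s /\ s <= 1.
  by rewrite /s; case: ifPn => [t2|]; rewrite -?ltNge => *; split; lra.
have sd : `|t - s| = d.
  rewrite /s; case: ifPn => _; first by rewrite opprD addNKr normrN gtr0_norm.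
  by rewrite opprB addrC subrK gtr0_norm.
exists s; apply: He => /=; first by rewrite /ball /= sd.
  by apply/eqP => st; move: d0; rewrite -sd st subrr normr0 ltxx.
by rewrite in_itv /= s0.
Qed.

Lemma tder_lim W (g : R -> W) t l : 0 <= t <= 1 -> is_time_derive g t l ->
  time_derive g t = l.
Proof. by move=> /unit_time_proper pf gl; exact: cvg_lim gl. Qed.

Lemma tder_unique W (g : R -> W) t l l' : 0 <= t <= 1 ->
  is_time_derive g t l -> is_time_derive g t l' -> l = l'.
Proof. by move=> t01 h1 h2; rewrite -(tder_lim t01 h1) -(tder_lim t01 h2). Qed.

Lemma tder_near W (g g' : R -> W) (t : R) l : 0 <= t <= 1 ->
  (\forall s \near t, 0 <= s <= 1 -> g s = g' s) -> is_time_derive g t l ->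
    is_time_derive g' t l.
Proof.
move=> t01 gg'; apply: cvg_trans; apply: near_eq_cvg.
have gt := nbhs_singleton gg' t01.
rewrite /prop_near1; apply: filterS gg' => s gg' st.
rewrite /= in_itv /= => s01.
by rewrite gt gg'.
Qed.

Lemma tder_eq W (g g' : R -> W) (t : R) l : 0 <= t <= 1 ->
  (forall s, 0 <= s <= 1 -> g s = g' s) -> is_time_derive g t l ->
    is_time_derive g' t l.
Proof.
move=> t01 gg'; apply: (@tder_near _ g g') => //; near=> s; exact: gg'.
Unshelve. all: by end_near. Qed.

Lemma tder_derivable W (g : R -> W) t : derivable g t 1 ->
    is_time_derive g t ('D_1 g t).
Proof.
move=> dg; rewrite /is_time_derive; apply: cvg_within_filter.
apply/cvgrPdist_le => e e0; move/cvgrPdist_le : dg => /(_ e e0).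
move=> /nbhs_ballP [d /= d0 hd].
apply/nbhs_ballP; exists d => //= s /= ts st.
have := hd (s - t); rewrite /= [(s - t)%:A]mulr1 subrK; apply.
  by rewrite /ball /= sub0r opprB.
by rewrite subr_eq0.
Qed.

Lemma tder_cst W (a : W) t : is_time_derive (fun=> a) t 0.
Proof.
rewrite /is_time_derive; under eq_fun do rewrite subrr scaler0; exact: cvg_cst.
Qed.

Lemma tderD W (g h : R -> W) t l l' : is_time_derive g t l ->
    is_time_derive h t l' ->
  is_time_derive (fun s => g s + h s) t (l + l').
Proof.
move=> gl hl; rewrite /is_time_derive.
under eq_fun do rewrite opprD addrACA scalerDr.
exact: cvgD.
Qed.

Lemma tder_linear W W' (L : W -> W') (g : R -> W) t l :
  linear L -> continuous L -> is_time_derive g t l ->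
    is_time_derive (L \o g) t (L l).
Proof.
move=> Ll Lc gl; rewrite /is_time_derive.
have -> : (fun s => (s - t)^-1 *: ((L \o g) s - (L \o g) t))
    = L \o (fun s => (s - t)^-1 *: (g s - g t)).
  by apply/funext => s /=; rewrite linear_scaleB.
exact: (cvg_comp (fun s => (s - t)^-1 *: (g s - g t)) L gl (Lc _)).
Qed.

Lemma tderN W (g : R -> W) t l : is_time_derive g t l ->
    is_time_derive (fun s => - g s) t (- l).
Proof.
move=> gl; rewrite /is_time_derive; under eq_fun do rewrite -opprD scalerN.
exact: cvgN.
Qed.

(** The difference quotient of a product is the expected sum plus a
    remainder with a factor s - t. *)
Lemma tderM (g h : R -> R) t l l' : is_time_derive g t l ->
    is_time_derive h t l' ->
  is_time_derive (fun s => g s * h s) t (l * h t + g t * l').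
Proof.
move=> gl hl.
have idl : (s - t) @[s --> within `[0, 1] (t^')] --> (0 : R).
  apply: cvg_within_filter; apply: cvg_within_filter.
  have : (s - t) @[s --> t] --> t - t.
    by apply: cvgB; [exact: cvg_id|exact: cvg_cst].
  by rewrite subrr.
have gl' : ((s - t)^-1 * (g s - g t)) @[s --> within `[0,
    1] (t^')] --> l by exact: gl.
have hl' : ((s - t)^-1 * (h s - h t)) @[s --> within `[0,
    1] (t^')] --> l' by exact: hl.
have H : ((s - t)^-1 * (g s - g t) * h t + g t * ((s - t)^-1 * (h s - h t))
    + (s - t) * ((s - t)^-1 * (g s - g t)) * ((s - t)^-1 * (h s - h t)))
    @[s --> within `[0, 1] (t^')] --> l * h t + g t * l' + 0 * l * l'.
  apply: cvgD; last by apply: cvgM hl'; exact: cvgM.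
  apply: cvgD; first by apply: cvgM gl' _; exact: cvg_cst.
  by apply: cvgM => //; exact: cvg_cst.
suff : ((s - t)^-1 * (g s * h s - g t * h t)) @[s --> within `[0, 1] (t^')]
    --> l * h t + g t * l' by [].
move: H; rewrite !mul0r addr0; apply: cvg_trans.
apply: near_eq_cvg; rewrite /prop_near1.
apply: filterS (@filterT _ (nbhs t) _) => s _ /= st _;
  have {}st : s - t != 0 by rewrite subr_eq0.
by field.
Qed.

Lemma tder_sum W I (r : seq I) (g : I -> R -> W) t (l : I -> W) :
  (forall i, is_time_derive (g i) t (l i)) ->
  is_time_derive (fun s => \sum_(i <- r) g i s) t (\sum_(i <- r) l i).
Proof.
move=> h; elim: r => [|i r IH].
  under eq_fun do rewrite big_nil; rewrite big_nil; exact: tder_cst.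
under eq_fun do rewrite big_cons; rewrite big_cons.
exact: tderD.
Qed.

Lemma tder_mx m n (M : R -> 'M[R]_(m, n)) t (L : 'M[R]_(m, n)) :
  (forall i j, is_time_derive (fun s => M s i j) t (L i j)) ->
    is_time_derive M t L.
Proof.
move=> h; apply/cvgrPdist_le => /= e e0.
near=> s.
rewrite [leLHS]/Num.Def.normr/= mx_normrE (bigmax_le _ (ltW e0))//= => i _.
rewrite !mxE/=.
move: i; near: s; apply: filter_forall => /= i.
by have /cvgrPdist_le := h i.1 i.2; apply.
Unshelve. all: by end_near. Qed.

Lemma tder_coord m n (M : R -> 'M[R]_(m, n)) t (L : 'M[R]_(m, n)) i j :
  is_time_derive M t L -> is_time_derive (fun s => M s i j) t (L i j).
Proof.
apply: (@tder_linear 'M[R]_(m, n) R (fun v => v i j)).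
  by move=> a u v; rewrite !mxE.
exact: coord_continuous.
Qed.

Lemma tder_mulmx m n p (M : R -> 'M[R]_(m, n)) (N : R -> 'M[R]_(n, p)) t M' N' :
  is_time_derive M t M' -> is_time_derive N t N' ->
  is_time_derive (fun s => M s *m N s) t (M' *m N t + M t *m N').
Proof.
move=> hM hN; apply: tder_mx => i j.
under eq_fun do rewrite mxE.
have -> : (M' *m N t + M t *m N') i j
    = \sum_k (M' i k * N t k j + M t i k * N' k j).
  by rewrite !mxE -big_split.
apply: tder_sum => k; apply: tderM; exact: tder_coord.
Qed.

Lemma tder_tr m n (M : R -> 'M[R]_(m, n)) t M' :
  is_time_derive M t M' -> is_time_derive (fun s => (M s)^T) t M'^T.
Proof.
move=> hM; apply: tder_mx => i j; rewrite mxE.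
by under eq_fun do rewrite mxE; exact: tder_coord.
Qed.

End TimeDerivative.

(** * Families of functions over the unit interval *)

Lemma pair_continuousr (T U : topologicalType) (s : T) :
  continuous (fun y : U => (s, y)).
Proof.
by move=> y; apply: (@cvg_pair _ _ _ _ (nbhs s) (nbhs y));
  [exact: cvg_cst|exact: cvg_id].
Qed.

Lemma pair_continuousl (T U : topologicalType) (y : U) :
  continuous (fun s : T => (s, y)).
Proof.
by move=> s; apply: (@cvg_pair _ _ _ _ (nbhs s) (nbhs y));
  [exact: cvg_id|exact: cvg_cst].
Qed.

Section SpaceTime.
Context {R : realType} {V : normedModType R}.
Implicit Types (W : normedModType R) (O : set V).

Definition unit_time O : set (R * V)%type := `[0, 1] `*` O.

Lemma unit_timeP O s y : unit_time O (s, y) <-> 0 <= s <= 1 /\ O y.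
Proof. by rewrite /unit_time /= in_itv /=. Qed.

Lemma pair_affiner (s h : R) (v y : V) :
  (s, h *: v + y) = h *: (0, v) + (s, y) :> (R * V)%type.
Proof. by congr (_, _); rewrite -[LHS]add0r -[X in X + _](mulr0 h). Qed.

Lemma pair_affinel (y : V) (h v s : R) :
  (h *: v + s, y) = h *: (v, 0) + (s, y) :> (R * V)%type.
Proof. by congr (_, _); rewrite -[LHS]add0r -[X in X + _](scaler0 _ h). Qed.

Lemma smooth_germ_static W O (f : V -> W) t x :
  smooth_germ O f x -> smooth_germ (unit_time O) (fun z => f z.2) (t, x).
Proof.
move=> h; apply: (@smooth_germ_affine _ _ _ _ O _ f snd snd) => //.
- by move=> z; exact: cvg_snd.
- by move=> z [].
Qed.

Lemma smooth_germ_slice W O (F : R * V -> W) t x : 0 <= t <= 1 ->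
  smooth_germ (unit_time O) F (t, x) -> smooth_germ O (fun y => F (t, y)) x.
Proof.
move=> t01 h.
apply: (@smooth_germ_affine _ _ _ _ (unit_time O) _ F (fun y => (t,
  y)) (fun v => (0, v))) => //.
  exact: pair_continuousr.
by move=> r v y; exact: pair_affiner.
Qed.

Section Extension.
Variables (W : normedModType R) (O : set V) (F g : R * V -> W).
Variable (U : set (R * V)%type).
Hypotheses (oO : open O) (oU : open U) (sg : forall k, Ck k U g).
Hypothesis (gF : forall z, unit_time O z -> U z -> g z = F z).

(** At fixed time the domain is open in space, so a family and its extension
    have the same spatial derivatives. *)
Lemma extension_space_derive s y v : unit_time O (s, y) -> U (s, y) ->
  'D_v (fun y => F (s, y)) y = 'D_((0, v)) g (s, y).
Proof.
move=> /unit_timeP [s01 Oy] Uy.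
rewrite -(@derive_affine _ _ _ _ g (fun y => (s, y)) (fun v => (0, v)));
  last first.
  by move=> h w x; exact: pair_affiner.
apply/esym/near_eq_derive; near=> y'; rewrite /= gF //.
  apply/unit_timeP; split => //; near: y'; exact: open_nbhs_nbhs.
near: y'; apply: (@pair_continuousr R V s y); exact: open_nbhs_nbhs.
Unshelve. all: by end_near. Qed.

(** At the end points of [0, 1] the one-sided derivative of the family is
    the ordinary derivative of the extension. *)
Lemma extension_tder s y : unit_time O (s, y) -> U (s, y) ->
  is_time_derive (fun s => F (s, y)) s ('D_((1, 0)) g (s, y)).
Proof.
move=> /unit_timeP [s01 Oy] Uy.
have LE (h v x : R) : (h *: v + x, y) = h *: (v, 0 : V) + (x,
    y) :> (R * V)%type.
  exact: pair_affinel.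
have -> : 'D_((1, 0)) g (s, y) = 'D_1 (fun s => g (s, y)) s.
  by rewrite -(@derive_affine _ _ _ _ g (fun s => (s, y)) (fun v => (v, 0))).
apply: (@tder_near _ _ (fun s => g (s, y))) => //.
  near=> r => r01; rewrite gF //.
  near: r; apply: (@pair_continuousl R V y s); exact: open_nbhs_nbhs.
apply: tder_derivable.
have : Ck 1 [set s | U (s, y)] (g \o (fun s => (s, y))).
  apply: (@Ck_affine _ _ _ _ 1 U _ g (fun s => (s, y)) (fun v => (v, 0))) => //.
  exact: pair_continuousl.
by move=> [_ /(_ 1) [+ _]]; apply.
Unshelve. all: by end_near. Qed.

End Extension.

Lemma smooth_germ_space_derive W O (F : R * V -> W) t x v : open O ->
  smooth_germ (unit_time O) F (t, x) ->
  smooth_germ (unit_time O) (fun z => 'D_v (fun y => F (z.1, y)) z.2) (t, x).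
Proof.
move=> oO [U [g [oU Ux sg gF]]]; exists U, ('D_((0, v)) g); split => //.
  by move=> k; have [_ /(_ (0, v)) []] := sg k.+1.
by move=> [s y] Oz Uz; rewrite -(extension_space_derive oO oU gF).
Qed.

Lemma smooth_germ_tder W O (F : R * V -> W) t x : O x -> 0 <= t <= 1 ->
  smooth_germ (unit_time O) F (t, x) ->
  is_time_derive (fun s => F (s, x)) t (time_derive (fun s => F (s, x)) t).
Proof.
move=> Ox t01 [U [g [oU Ux sg gF]]].
have H := extension_tder oU sg gF (proj2 (unit_timeP _ _ _) (conj t01 Ox)) Ux.
by rewrite (tder_lim t01 H).
Qed.

Lemma smooth_germ_time_derive W O (F : R * V -> W) t x :
  smooth_germ (unit_time O) F (t, x) ->
  smooth_germ (unit_time O) (fun z => time_derive (fun s => F (s,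
    z.2)) z.1) (t, x).
Proof.
move=> [U [g [oU Ux sg gF]]]; exists U, ('D_((1, 0)) g); split => //.
  by move=> k; have [_ /(_ (1, 0)) []] := sg k.+1.
move=> [s y] Oz Uz; have /unit_timeP [s01 Oy] := Oz.
by rewrite (tder_lim s01 (extension_tder oU sg gF Oz Uz)).
Qed.

(** This is the symmetry of second derivatives of the extension, in the
    directions (1, 0) and (0, v). *)
Lemma tder_space_derive O (F : R * V -> R) t x v : open O -> O x ->
  0 <= t <= 1 -> smooth_germ (unit_time O) F (t, x) ->
  is_time_derive (fun s => 'D_v (fun y => F (s, y)) x) t
    ('D_v (fun y => time_derive (fun s => F (s, y)) t) x).
Proof.
move=> oO Ox t01 [U [g [oU Ux sg gF]]].
have tx := proj2 (unit_timeP O t x) (conj t01 Ox).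
have H1 := @extension_tder R O
  (fun z => 'D_v (fun y => F (z.1, y)) z.2) ('D_((0, v)) g) U oU.
have {}H1 := H1 _ _ t x tx Ux.
have H2 := @extension_space_derive R O
  (fun z => time_derive (fun s => F (s, z.2)) z.1) ('D_((1, 0)) g) U oO oU.
rewrite (H2 _ t x v tx Ux) /=; last first.
  move=> [s y] Oz Uz; have /unit_timeP [s01 Oy] := Oz.
  by rewrite (tder_lim s01 (extension_tder oU sg gF Oz Uz)).
rewrite -(@schwarz R _ U g (t, x) (1, 0) (0, v) oU Ux (sg 2%N)).
apply: H1; first by move=> k; have [_ /(_ (0, v)) []] := sg k.+1.
by move=> [s y] Oz Uz; rewrite -(extension_space_derive oO oU gF).
Qed.

End SpaceTime.

(** * Smooth families in charts *)

Section ChartGerms.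
Context {R : realType} {n : nat} {M : manifold R n}.
Implicit Types (c : chart M 'rV[R]_n) (p : M) (t : R) (W : normedModType R).

Definition chart_image c : set 'rV[R]_n := cmap c @` cdom c.

Section OneChart.
Variable c : chart M 'rV[R]_n.
Hypothesis ac : atlas c.

Lemma cdom_open : open (cdom c).
Proof. by have [] := atlas_is_chart ac. Qed.

Lemma image_open : open (chart_image c).
Proof. by have [] := atlas_is_chart ac. Qed.

Lemma cmapK p : cdom c p -> cinv c (cmap c p) = p.
Proof. by have [_ _ + _ _] := atlas_is_chart ac; apply. Qed.

Lemma image_cmap p : cdom c p -> chart_image c (cmap c p).
Proof. by move=> cp; exists p. Qed.

Lemma cinvK y : chart_image c y -> cmap c (cinv c y) = y.
Proof. by move=> [p cp <-]; rewrite cmapK. Qed.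

Lemma cdom_cinv y : chart_image c y -> cdom c (cinv c y).
Proof. by move=> [p cp <-]; rewrite cmapK. Qed.

Lemma cmap_continuous p : cdom c p -> {for p, continuous (cmap c)}.
Proof.
move=> cp; have [oc _ _ + _] := atlas_is_chart ac.
rewrite continuous_open_subspace // => /(_ p); apply.
by rewrite inE.
Qed.

Lemma cinv_continuous y : chart_image c y -> {for y, continuous (cinv c)}.
Proof.
move=> cy; have [_ oi _ _] := atlas_is_chart ac.
rewrite continuous_open_subspace // => /(_ y); apply.
by rewrite inE.
Qed.

Lemma near_cdom p : cdom c p -> \forall p' \near p, cdom c p'.
Proof. by move=> cp; apply: open_nbhs_nbhs; split => //; exact: cdom_open. Qed.

Lemma near_image p : cdom c p -> \forall y \near cmap c p, chart_image c y.
Proof.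
by move=> cp; apply: open_nbhs_nbhs; split;
  [exact: image_open|exact: image_cmap].
Qed.

Lemma near_cinv (P : set M) p : cdom c p -> (\forall p' \near p, P p') ->
  \forall y \near cmap c p, P (cinv c y).
Proof.
move=> cp; rewrite -{1}(cmapK cp); apply: cinv_continuous; exact: image_cmap.
Qed.

Lemma near_cmap (P : set 'rV[R]_n) p : cdom c p ->
  (\forall y \near cmap c p, P y) -> \forall p' \near p, P (cmap c p').
Proof. by move=> cp; exact: (cmap_continuous cp). Qed.

End OneChart.

(** Joint smoothness in time and space of a family of functions, read in the
    chart c. *)
Definition family_germ W c (f : R -> M -> W) (t : R) p : Prop :=
  smooth_germ (unit_time (chart_image c)) (fun z => f z.1 (cinv c z.2)) (t,
    cmap c p).

Lemma near_pair (V : normedModType R) (P : set V) (t : R) (x : V) :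
  (\forall y \near x, P y) -> \forall z \near (t, x), P z.2.
Proof. exact: (@cvg_snd _ _ (nbhs t) (nbhs x)). Qed.

Lemma near_cinv_time (P : set (R * M)) c t p : atlas c -> cdom c p ->
  (\forall z \near (t, p), P z) ->
  \forall z \near (t, cmap c p), P (z.1, cinv c z.2).
Proof.
move=> ac cp H.
have E : (t, p) = (t, cinv c (cmap c p)) by rewrite cmapK.
rewrite E in H.
have cc : {for (t, cmap c p), continuous (fun z : R * 'rV[R]_n => (z.1,
    cinv c z.2))}.
  apply: (@cvg_pair _ _ _ _ (nbhs t) (nbhs (cinv c (cmap c p)))).
    exact: cvg_fst.
  exact: (cvg_comp snd (cinv c) (@cvg_snd _ _ (nbhs t) (nbhs (cmap c p)) _)
    (cinv_continuous ac (image_cmap cp))).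
exact: cc H.
Qed.

Lemma near_cmap_time (P : set (R * 'rV[R]_n)) c t p : atlas c -> cdom c p ->
  (\forall z \near (t, cmap c p), P z) ->
  \forall z \near (t, p), P (z.1, cmap c z.2).
Proof.
move=> ac cp.
suff : {for (t, p), continuous (fun z : R * M => (z.1, cmap c z.2))} by apply.
apply: (@cvg_pair _ _ _ _ (nbhs t) (nbhs (cmap c p))).
  exact: cvg_fst.
exact: (cvg_comp snd (cmap c) (@cvg_snd _ _ (nbhs t) (nbhs p) _)
  (cmap_continuous ac cp)).
Qed.

(** Nearness is joint in time and space: two expressions of a family may
    agree only where f s is differentiable, which is known for s near t. *)
Lemma family_germ_near_time W c (f f' : R -> M -> W) t p : atlas c ->
    cdom c p ->
  (\forall z \near (t, p), 0 <= z.1 <= 1 -> f z.1 z.2 = f' z.1 z.2) ->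
  family_germ c f t p -> family_germ c f' t p.
Proof.
move=> ac cp ff'; apply: smooth_germ_near.
have := near_cinv_time ac cp ff'.
apply: filterS => -[s y] /= H Az; split => //; apply: H.
by have /unit_timeP [] := Az.
Qed.

Lemma family_germ_near W c (f f' : R -> M -> W) t p : atlas c -> cdom c p ->
  (\forall p' \near p, forall s, 0 <= s <= 1 -> f s p' = f' s p') ->
  family_germ c f t p -> family_germ c f' t p.
Proof.
move=> ac cp ff'; apply: family_germ_near_time => //.
have : \forall z \near (t, p), forall s, 0 <= s <= 1 -> f s z.2 = f' s z.2.
  exact: (@cvg_snd _ _ (nbhs t) (nbhs p) _ _ ff').
by apply: filterS => z; apply.
Qed.

Lemma family_germ_family W c (D : set M) (f : R -> M -> W) t p : atlas c ->
  cdom c p -> (\forall p' \near p, D p') -> 0 <= t <= 1 ->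
  smooth_family_on D f -> family_germ c f t p.
Proof.
move=> ac cp Dp t01 sf.
have sA : smooth_germ (unit_time (cmap c @` (cdom c `&` D)))
    (fun z => f z.1 (cinv c z.2)) (t, cmap c p).
  apply: sf => //; apply/unit_timeP; split => //; exists p => //; split => //.
  exact: nbhs_singleton Dp.
apply: smooth_germ_near sA.
have /(near_pair t) := near_cinv ac cp Dp.
apply: filterS => -[s y] /= Dy /unit_timeP [s01 iy]; split => //.
apply/unit_timeP; split => //; exists (cinv c y).
  by split => //; exact: cdom_cinv.
exact: cinvK.
Qed.

Lemma family_germ_static W c (f : M -> W) t p :
  smooth_germ (chart_image c) (f \o cinv c) (cmap c p) ->
    family_germ c (fun=> f) t p.
Proof. exact: smooth_germ_static. Qed.

Lemma family_germ_slice W c (f : R -> M -> W) t p : 0 <= t <= 1 ->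
  family_germ c f t p -> smooth_germ (chart_image c) (f t \o cinv c) (cmap c p).
Proof. exact: smooth_germ_slice. Qed.

Lemma family_germ_cst W c (a : W) t p : family_germ c (fun _ _ => a) t p.
Proof. exact: smooth_germ_cst. Qed.

Lemma family_germM c (f g : R -> M -> R) t p :
  family_germ c f t p -> family_germ c g t p ->
    family_germ c (fun s q => f s q * g s q) t p.
Proof. exact: smooth_germM. Qed.

Lemma family_germ_sum W c I (r : seq I) (f : I -> R -> M -> W) t p :
  (forall i, family_germ c (f i) t p) ->
  family_germ c (fun s q => \sum_(i <- r) f i s q) t p.
Proof. exact: (@smooth_germ_sum _ _ _ _ _ r (fun i z =>
  f i z.1 (cinv c z.2))). Qed.

Lemma family_germ_nbhs_time W c (f : R -> M -> W) t p : atlas c -> cdom c p ->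
  family_germ c f t p -> \forall z \near (t, p), family_germ c f z.1 z.2.
Proof. by move=> ac cp /smooth_germ_nbhs /(near_cmap_time ac cp). Qed.

Lemma transition_smooth_germ c c' p : atlas c -> atlas c' -> cdom c p ->
    cdom c' p ->
  smooth_germ (chart_image c) (cmap c' \o cinv c) (cmap c p).
Proof.
move=> ac ac' cp c'p.
have := @atlas_compatible _ _ M c c' ac ac' (cmap c p).
case; first by exists p.
move=> U [g [oU Ux sg gf]].
have H : smooth_germ (cmap c @` (cdom c `&` cdom c')) (cmap c' \o cinv c) (cmap
    c p).
  by exists U, g.
apply: smooth_germ_near H; have := near_cinv ac cp (near_cdom ac' c'p).
apply: filterS => y c'y iy; split => //; exists (cinv c y).
  by split => //; exact: cdom_cinv.
exact: cinvK.
Qed.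

(** The change of coordinates (s, y) |-> (s, cmap c (cinv c' y)) is smooth
    on the overlap of the charts, to which the domain is first restricted. *)
Lemma family_germ_change c c' (f : R -> M -> R) t p : atlas c -> atlas c' ->
  cdom c p -> cdom c' p -> 0 <= t <= 1 -> family_germ c f t p ->
    family_germ c' f t p.
Proof.
move=> ac ac' cp c'p t01 sf.
pose A := unit_time (chart_image c' `&` [set y | cdom c (cinv c' y)]).
pose g (z : R * 'rV[R]_n) : R * 'rV[R]_n := (z.1, cmap c (cinv c' z.2)).
have Ap : A (t, cmap c' p).
  apply/unit_timeP; split => //; split; first exact: image_cmap.
  by rewrite /= cmapK.
have gp : g (t, cmap c' p) = (t, cmap c p) by rewrite /g /= cmapK.
have sg : smooth_germ A g (t, cmap c' p).
  have -> : g = (fun z => (z.1, 0) + (0, cmap c (cinv c' z.2))).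
    by apply/funext => z; rewrite /g; congr (_, _); rewrite ?addr0 ?add0r.
  apply: smooth_germD.
    exists setT, (fun z => (z.1, 0)); split => //; first exact: openT.
    move=> k.
    apply: (@Ck_linear_comp _ _ _ _ k setT (fun z : R * 'rV[R]_n => (z.1,
      0 : 'rV[R]_n)) id).
    - exact: openT.
    - move=> a u v; congr (_, _);
      exact: (esym (etrans (addr0 _) (scaler0 _ a))).
    - move=> z; apply: (@cvg_pair _ _ _ _ (nbhs z.1) (nbhs (0 : 'rV[R]_n))).
        exact: cvg_fst.
      exact: cvg_cst.
    - exact: Ck_id.
  apply: (@smooth_germ_linear_comp _ _ _ _ _ (fun v : 'rV[R]_n => (0 : R, v))
    (fun z => cmap c (cinv c' z.2))).
  - move=> a u v; congr (_, _); exact: (esym (etrans (addr0 _) (mulr0 a))).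
  - exact: pair_continuousr.
  - have /(@smooth_germ_static _ _ _ _ _ t) :=
    transition_smooth_germ ac' ac c'p cp.
    apply: smooth_germ_eq => -[s y] /unit_timeP [s01 [y1 y2]].
    by split => //; apply/unit_timeP.
have sf' : smooth_germ (unit_time (chart_image c)) (fun z =>
    f z.1 (cinv c z.2)) (g (t, cmap c' p)).
  by rewrite gp.
have gA z : A z -> unit_time (chart_image c) (g z).
  case: z => s y /unit_timeP [s01 [y1 y2]]; apply/unit_timeP; split => //.
  exact: image_cmap.
have H := smooth_germ_comp (findim_prod (@findim_real R) (@findim_rV R n)) gA
    Ap sf' sg.
apply: smooth_germ_near H.
have /(near_pair t) := near_cinv ac' c'p (near_cdom ac cp).
apply: filterS => -[s y] Dy /unit_timeP [s01 iy]; split.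
  by apply/unit_timeP; split.
by rewrite /g /= cmapK.
Qed.

Lemma family_germ_derive W c (f : R -> M -> W) t p v : atlas c -> cdom c p ->
  family_germ c f t p ->
  family_germ c (fun s q => 'D_v (f s \o cinv c) (cmap c q)) t p.
Proof.
move=> ac cp /(@smooth_germ_space_derive _ _ _ _ _ _ _ v (image_open ac)).
apply: smooth_germ_eq => -[s y] /= /unit_timeP [s01 iy]; split.
  exact/unit_timeP.
by rewrite cinvK.
Qed.

Lemma family_germ_time_derive W c (f : R -> M -> W) t p :
  family_germ c f t p -> family_germ c (fun s q => time_derive (f^~ q) s) t p.
Proof. exact: smooth_germ_time_derive. Qed.

Lemma family_germ_tder W c (f : R -> M -> W) t p : atlas c -> cdom c p ->
  0 <= t <= 1 -> family_germ c f t p ->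
    is_time_derive (f^~ p) t (time_derive (f^~ p) t).
Proof.
move=> ac cp t01 /(smooth_germ_tder (image_cmap cp) t01) /=.
by rewrite cmapK.
Qed.

Lemma family_germ_tder_derive c (f : R -> M -> R) t p v : atlas c -> cdom c p ->
  0 <= t <= 1 -> family_germ c f t p ->
  is_time_derive (fun s => 'D_v (f s \o cinv c) (cmap c p)) t
    ('D_v ((fun q => time_derive (f^~ q) t) \o cinv c) (cmap c p)).
Proof.
move=> ac cp t01 sf.
exact: (@tder_space_derive R _ (chart_image c) (fun z => f z.1 (cinv c z.2))
  t (cmap c p) v (image_open ac) (image_cmap cp) t01 sf).
Qed.

Lemma family_germ_rV m c (f : R -> M -> 'rV[R]_m) t p :
  (forall i, family_germ c (fun s q => f s q 0 i) t p) -> family_germ c f t p.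
Proof. exact: smooth_germ_rV. Qed.

End ChartGerms.

(** * Differentials and brackets on a manifold *)

Section Differentiability.
Context {R : realType}.
Implicit Types V W : normedModType R.

Lemma near_eq_differentiable V W (f g : V -> W) x : {near x, f =1 g} ->
  differentiable f x -> differentiable g x /\ 'd g x = 'd f x :> (V -> W).
Proof.
move=> fg df; apply: differentiable_eps; first exact: diff_continuous.
have /diff_locallyP [_ /eqaddoP H] := df.
move=> e e0; have fg0 : \forall h \near 0, f (h + x) = g (h + x).
  have : \forall y \near x, f y = g y by [].
  by rewrite (near_shift 0) /= subr0.
near=> h.
rewrite -(nbhs_singleton fg) -(near fg0 h) //.
by near: h; exact: H.
Unshelve. all: by end_near. Qed.

End Differentiability.

Section ManifoldCalculus.
Context {R : realType} {n : nat} {M : manifold R n}.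
Implicit Types (c : chart M 'rV[R]_n) (p : M) (t : R) (W : normedModType R).

Definition differentiable_at W (f : M -> W) p : Prop :=
  differentiable (f \o cinv (chart_at p)) (cmap (chart_at p) p).

Let atp p : atlas (chart_at p) := @atlas_chart_at _ _ M p.
Let mem p : cdom (chart_at p) p := @mem_chart_at _ _ M p.

Lemma transition_differentiable c c' p : atlas c -> atlas c' -> cdom c p ->
  cdom c' p -> differentiable (cmap c' \o cinv c) (cmap c p).
Proof.
move=> ac ac' cp c'p; apply: differentiable_rV => i.
apply: (smooth_germ_differentiable (findim_rV n) (image_open ac) (image_cmap
  cp)).
exact: (smooth_germ_coord 0 i (transition_smooth_germ ac ac' cp c'p)).
Qed.

Lemma near_transition W c c' (f : M -> W) p : atlas c -> atlas c' -> cdom c p ->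
  cdom c' p ->
  {near cmap c' p, (f \o cinv c) \o (cmap c \o cinv c') =1 f \o cinv c'}.
Proof.
move=> ac ac' cp c'p.
have := near_cinv ac' c'p (near_cdom ac cp).
by apply: filterS => y /= cy; rewrite cmapK.
Qed.

Lemma differentiable_change W c c' (f : M -> W) p : atlas c -> atlas c' ->
  cdom c p -> cdom c' p -> differentiable (f \o cinv c) (cmap c p) ->
  differentiable (f \o cinv c') (cmap c' p).
Proof.
move=> ac ac' cp c'p df.
have [] // := near_eq_differentiable (near_transition f ac ac' cp c'p).
apply: differentiable_comp; first exact: transition_differentiable.
by rewrite /= cmapK.
Qed.

Lemma mdiff_chart W c (f : M -> W) p : atlas c -> cdom c p ->
  differentiable_at f p <-> differentiable (f \o cinv c) (cmap c p).
Proof.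
by move=> ac cp; split => h; [apply: (differentiable_change (atp p))|
  apply: (differentiable_change ac)].
Qed.

(** Tangent vectors at p are written in the frame of chart_at p, which
    varies with p; the derivative in a fixed chart c is along their
    c-components. *)
Lemma tangent_chart W c (f : M -> W) p v : atlas c -> cdom c p ->
    differentiable_at f p ->
  tangent_fun f p v = 'd (f \o cinv c) (cmap c p) (tangent_fun (cmap c) p v).
Proof.
move=> ac cp /(mdiff_chart _ ac cp) df; rewrite /tangent_fun.
rewrite -(near_eq_derive _ (near_transition f ac (atp p) cp (mem p))).
have dt := transition_differentiable (atp p) ac (mem p) cp.
have dfc : differentiable (f \o cinv c)
    ((cmap c \o cinv (chart_at p)) (cmap (chart_at p) p)) by rewrite /= cmapK.
have [_ ->] := derive_comp dfc (diff_derivable (v := v) dt).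
by rewrite /= cmapK.
Qed.

Lemma tangent_near W (f g : M -> W) p v : (\forall q \near p, f q = g q) ->
  tangent_fun f p v = tangent_fun g p v.
Proof.
move=> fg; apply: near_eq_derive.
exact: (near_cinv (atp p) (mem p) fg).
Qed.

Lemma dfun_near (f g : M -> R) p : (\forall q \near p, f q = g q) ->
  dfun f p = dfun g p.
Proof.
by move=> fg; apply/matrixP => i j; rewrite !mxE; exact: tangent_near.
Qed.

Lemma bracket_near (P : M -> 'M[R]_n) (f f' g g' : M -> R) p :
  (\forall q \near p, f q = f' q) -> (\forall q \near p, g q = g' q) ->
  bracket P f g p = bracket P f' g' p.
Proof. by move=> ff' gg'; rewrite /bracket (dfun_near ff') (dfun_near gg'). Qed.

Lemma tangent_dfun (f : M -> R) p v : differentiable_at f p ->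
  tangent_fun f p v = (v *m dfun f p) 0 0.
Proof.
move=> df; rewrite /tangent_fun deriveE // {1}(row_sum_delta v) linear_sum mxE.
apply: eq_bigr => i _; rewrite linearZ mxE /tangent_fun deriveE //.
Qed.

Lemma tangent_coord m (f : M -> 'rV[R]_m) p v j : differentiable_at f p ->
  tangent_fun f p v 0 j = tangent_fun (fun q => f q 0 j) p v.
Proof.
move=> df; rewrite /tangent_fun derive_mx ?mxE //.
exact: diff_derivable.
Qed.

Lemma mdiff_coord m (f : M -> 'rV[R]_m) p j : differentiable_at f p ->
  differentiable_at (fun q => f q 0 j) p.
Proof.
move=> df; apply: (@differentiable_comp R _ _ _ _ (fun N : 'rV[R]_m =>
  N 0 j)) => //.
exact: differentiable_coord.
Qed.

Lemma mdiff_rV m (f : M -> 'rV[R]_m) p :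
  (forall j, differentiable_at (fun q => f q 0 j) p) -> differentiable_at f p.
Proof. by move=> h; apply: differentiable_rV. Qed.

Lemma mdiff_cst W (a : W) p : differentiable_at (fun=> a) p.
Proof. exact: differentiable_cst. Qed.

Lemma dfun_cst (a : R) p : dfun (fun _ : M => a) p = 0.
Proof.
by apply/matrixP => i j; rewrite !mxE /tangent_fun derive_cst.
Qed.

Lemma mdiffD W (f g : M -> W) p : differentiable_at f p ->
    differentiable_at g p ->
  differentiable_at (fun q => f q + g q) p.
Proof. exact: differentiableD. Qed.

Lemma dfunD (f g : M -> R) p : differentiable_at f p -> differentiable_at g p ->
  dfun (fun q => f q + g q) p = dfun f p + dfun g p.
Proof.
move=> df dg; apply/matrixP => i j; rewrite !mxE /tangent_fun.
by apply: deriveD; exact: diff_derivable.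
Qed.

Lemma mdiffM (f g : M -> R) p : differentiable_at f p ->
    differentiable_at g p ->
  differentiable_at (fun q => f q * g q) p.
Proof. exact: differentiableM. Qed.

Lemma dfunM (f g : M -> R) p : differentiable_at f p -> differentiable_at g p ->
  dfun (fun q => f q * g q) p = f p *: dfun g p + g p *: dfun f p.
Proof.
move=> df dg; apply/matrixP => i j; rewrite !mxE /tangent_fun.
have := deriveM (diff_derivable (v := delta_mx 0 i) df)
  (diff_derivable (v := delta_mx 0 i) dg).
by rewrite /= cmapK.
Qed.

Lemma mdiffN (f : M -> R) p : differentiable_at f p ->
    differentiable_at (fun q => - f q) p.
Proof. exact: differentiableN. Qed.

Lemma dfunN (f : M -> R) p : differentiable_at f p ->
    dfun (fun q => - f q) p = - dfun f p.
Proof.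
move=> df; apply/matrixP => i j; rewrite !mxE /tangent_fun.
by apply: deriveN; exact: diff_derivable.
Qed.

Lemma bracketNl (P : M -> 'M[R]_n) (f g : M -> R) p : differentiable_at f p ->
  bracket P (fun q => - f q) g p = - bracket P f g p.
Proof.
by move=> df; rewrite /bracket /bivector_at dfunN // linearN /= !mulNmx mxE.
Qed.

Lemma mdiff_sum I (r : seq I) (f : I -> M -> R) p :
  (forall i, differentiable_at (f i) p) ->
    differentiable_at (fun q => \sum_(i <- r) f i q) p.
Proof.
move=> h; elim: r => [|i r IH].
  by under eq_fun do rewrite big_nil; exact: mdiff_cst.
by under eq_fun do rewrite big_cons; exact: mdiffD.
Qed.

Lemma dfun_sum I (r : seq I) (f : I -> M -> R) p :
  (forall i, differentiable_at (f i) p) ->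
  dfun (fun q => \sum_(i <- r) f i q) p = \sum_(i <- r) dfun (f i) p.
Proof.
move=> h; elim: r => [|i r IH].
  by under eq_fun do rewrite big_nil; rewrite big_nil dfun_cst.
under eq_fun do rewrite big_cons; rewrite big_cons dfunD ?IH //.
exact: mdiff_sum.
Qed.

Lemma mdiff_cmap c p : atlas c -> cdom c p -> differentiable_at (cmap c) p.
Proof. by move=> ac cp; exact: transition_differentiable. Qed.

Lemma mdiff_chart_coord c p a : atlas c -> cdom c p ->
    differentiable_at (chart_coord c a) p.
Proof. by move=> ac cp; exact/mdiff_coord/mdiff_cmap. Qed.

Lemma tangent_cmap_at p v : tangent_fun (cmap (chart_at p)) p v = v.
Proof.
rewrite /tangent_fun -[RHS](@derive_id R 'rV[R]_n (cmap (chart_at p) p) v).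
apply: near_eq_derive.
have := near_image (atp p) (mem p); apply: filterS => y /=; exact: cinvK.
Qed.

Lemma dfun_chart_coord_at p a :
    dfun (chart_coord (chart_at p) a) p = delta_mx a 0.
Proof.
apply/matrixP => i j; rewrite !mxE -tangent_coord; last exact: mdiff_cmap.
by rewrite tangent_cmap_at !mxE /= ord1 eqxx andbT eq_sym.
Qed.

Lemma bracket_chart_coord_at (P : M -> 'M[R]_n) p a b :
  bracket P (chart_coord (chart_at p) a) (chart_coord (chart_at p) b) p = P p a
    b.
Proof.
rewrite /bracket /bivector_at !dfun_chart_coord_at trmx_delta.
by rewrite -rowE -colE !mxE.
Qed.

Lemma dfun_chart c (f : M -> R) p : atlas c -> cdom c p ->
    differentiable_at f p ->
  dfun f p = \sum_a 'D_(delta_mx 0 a) (f \o cinv c) (cmap c p)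
                    *: dfun (chart_coord c a) p.
Proof.
move=> ac cp df; apply/matrixP => i j; rewrite mxE (tangent_chart _ ac cp df).
set w := tangent_fun (cmap c) p _.
have dfc := (mdiff_chart f ac cp).1 df.
rewrite {1}(row_sum_delta w) linear_sum summxE; apply: eq_bigr => a _.
rewrite linearZ !mxE -deriveE // -tangent_coord; last exact: mdiff_cmap.
by rewrite mulrC.
Qed.

(** In a single chart around a point the bracket becomes a polynomial in
    first derivatives and in the brackets of coordinates, whereas the frames
    of the charts chart_at p may jump from one point to the next. Smoothness
    of brackets is read off this form. *)
Lemma bracket_chart c (P : M -> 'M[R]_n) (f g : M -> R) p : atlas c ->
  cdom c p -> differentiable_at f p -> differentiable_at g p ->
  bracket P f g p = \sum_a \sum_b
    'D_(delta_mx 0 a) (f \o cinv c) (cmap c p) *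
    'D_(delta_mx 0 b) (g \o cinv c) (cmap c p) *
    bracket P (chart_coord c a) (chart_coord c b) p.
Proof.
move=> ac cp df dg; rewrite /bracket /bivector_at (dfun_chart ac cp df).
rewrite (dfun_chart ac cp dg) [(\sum_a _)^T]linear_sum /= !mulmx_suml summxE.
apply: eq_bigr => a _; rewrite linearZ /= -!scalemxAl mulmx_sumr scaler_sumr
  summxE.
by apply: eq_bigr => b _; rewrite -scalemxAr scalerA !mxE.
Qed.

Lemma bracket_suml (P : M -> 'M[R]_n) I (r : seq I) (f g : I -> M -> R) h p :
  (forall i, differentiable_at (f i) p) ->
    (forall i, differentiable_at (g i) p) ->
  bracket P (fun q => \sum_(i <- r) f i q * g i q) h p =
  \sum_(i <- r) (f i p * bracket P (g i) h p + g i p * bracket P (f i) h p).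
Proof.
move=> df dg; rewrite /bracket /bivector_at dfun_sum; last by move=> i;
  exact: mdiffM.
rewrite [(\sum_(i <- r) _)^T]linear_sum /= !mulmx_suml summxE;
  apply: eq_bigr => i _.
by rewrite dfunM // linearD /= !linearZ /= !mulmxDl mxE -!scalemxAl !mxE.
Qed.

Lemma bracket_skew (P : M -> 'M[R]_n) (f g : M -> R) p : (P p)^T = - P p ->
  bracket P f g p = - bracket P g f p.
Proof.
move=> sP; rewrite /bracket /bivector_at.
have -> : ((dfun f p)^T *m P p *m dfun g p) =
          ((dfun g p)^T *m (P p)^T *m dfun f p)^T.
  by rewrite !trmx_mul !trmxK mulmxA.
by rewrite sP mulmxN mulNmx !mxE.
Qed.

Lemma family_germ_mdiff c (f : R -> M -> R) t p : atlas c -> cdom c p ->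
    0 <= t <= 1 ->
  family_germ c f t p -> differentiable_at (f t) p.
Proof.
move=> ac cp t01 /(family_germ_slice t01) h; apply/(mdiff_chart _ ac cp).
exact: (smooth_germ_differentiable (findim_rV n) (image_open ac) (image_cmap
  cp)).
Qed.

Lemma family_germ_bracket (P : R -> M -> 'M[R]_n) c (f g : R -> M -> R) t p :
  smooth_bivector_family P -> atlas c -> cdom c p -> 0 <= t <= 1 ->
  family_germ c f t p -> family_germ c g t p ->
  family_germ c (fun s q => bracket (P s) (f s) (g s) q) t p.
Proof.
move=> [_ hP] ac cp t01 sf sg.
have H : family_germ c (fun s q => \sum_a \sum_b
    'D_(delta_mx 0 a) (f s \o cinv c) (cmap c q) *
    'D_(delta_mx 0 b) (g s \o cinv c) (cmap c q) *
    bracket (P s) (chart_coord c a) (chart_coord c b) q) t p.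
  apply: family_germ_sum => a; apply: family_germ_sum => b; apply: family_germM.
    by apply: family_germM; exact: family_germ_derive.
  apply: family_germ_family (hP c ac a b) => //.
  exact: near_cdom.
apply: family_germ_near_time H => //.
have cq : \forall z \near (t, p), cdom c z.2.
  exact: (@cvg_snd _ _ (nbhs t) (nbhs p) _ _ (near_cdom ac cp)).
apply: filterS3 cq (family_germ_nbhs_time ac cp sf) (family_germ_nbhs_time ac
  cp sg).
move=> [s q] /= cqq fq gq s01.
by rewrite (bracket_chart _ ac cqq (family_germ_mdiff ac cqq s01 fq)
  (family_germ_mdiff ac cqq s01 gq)).
Qed.

End ManifoldCalculus.

(** * A smooth plateau function *)

Section FlatFunction.
Context {R : realType}.

(** The functions x^-j exp (- 1 / x), continued by 0: allowing all j makes
    the family stable under differentiation. *)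
Definition flat (j : nat) (x : R) : R :=
  if 0 < x then x^-1 ^+ j * expR (- x^-1) else 0.

Lemma flat_ge0 j x : 0 <= flat j x.
Proof.
rewrite /flat; case: ifPn => // x0.
by rewrite mulr_ge0 ?expR_ge0 // exprn_ge0 // invr_ge0 ltW.
Qed.

Lemma flat_eq0 j x : x <= 0 -> flat j x = 0.
Proof. by rewrite /flat leNgt; case: ifPn. Qed.

Lemma flat_gt0 j x : 0 < x -> 0 < flat j x.
Proof.
by move=> x0; rewrite /flat x0 mulr_gt0 ?expR_gt0 // exprn_gt0 // invr_gt0.
Qed.

(** With y = 1 / x this is exp y >= y^(j+1) / (j+1)!; it makes the
    difference quotients at 0 vanish in the limit. *)
Lemma flat_bound j x : `|flat j x| <= (j.+1)`!%:R * `|x|.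
Proof.
have [x0|x0] := ltP 0 x; last by rewrite flat_eq0 // normr0 mulr_ge0.
rewrite !gtr0_norm ?flat_gt0 // /flat x0.
pose y := x^-1; have y0 : 0 < y by rewrite invr_gt0.
have yj : 0 < y ^+ j.+1 by rewrite exprn_gt0.
have f0 : 0 < (j.+1)`!%:R :> R by rewrite ltr0n fact_gt0.
rewrite -/y expRN ler_pdivrMr ?expR_gt0 //.
have := expR_ge1Dxn j (ltW y0) => H.
have {}H : y ^+ j.+1 / (j.+1)`!%:R <= expR y.
  by apply: le_trans H; rewrite lerDr.
rewrite ler_pdivrMr // in H.
have xy : x * y = 1 by rewrite divff // gt_eqF.
by rewrite mulrAC -(ler_pM2r y0) -exprSr -[leRHS]mulrA xy mulr1 mulrC.
Qed.

Lemma flat_derive (j : nat) (x : R) : is_derive x (1 :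
    R) (flat j) (flat j.+2 x - j%:R * flat j.+1 x).
Proof.
have [x0|x0|->] := ltgtP x 0.
- rewrite !flat_eq0 ?(ltW x0) // mulr0 subr0.
  apply: (near_eq_is_derive (f := fun=> 0)).
  near=> y; rewrite flat_eq0 //; apply: ltW; near: y; exact: lt_nbhsl.
- have dinv : is_derive x 1 (fun y : R => y^-1) (- x ^- 2).
    have dx := @derivable_id R R x 1.
    have x0' : (id x : R) != 0 by rewrite gt_eqF.
    split; first exact: (derivableV x0' dx).
    by rewrite (deriveV x0' dx) derive_id [_ *: _]mulr1.
  have dpow i : is_derive x 1 (fun y : R => y^-1 ^+ i) (- i%:R * x^-1 ^+ i.+1).
    elim: i => [|i IH].
      rewrite oppr0 mul0r; have := is_derive_cst (1 : R) x 1.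
      by congr (is_derive _ _ _ _).
    have H := is_deriveM IH dinv.
    have -> : (fun y : R => y^-1 ^+ i.+1) = (fun y => y^-1 ^+ i) * (fun y =>
        y^-1).
      by apply/funext => y; rewrite exprSr.
    apply: is_derive_eq H _.
    rewrite -natr1 -exprVn.
    have scE (a b : R) : a *: (b : R^o) = a * b by [].
    by rewrite !scE !exprS; ring.
  have dexp : is_derive x 1 (fun y : R =>
      expR (- y^-1)) (x^-1 ^+ 2 * expR (- x^-1)).
    have dn : is_derive x 1 (fun y : R => - y^-1) (x ^- 2).
      by have := is_deriveN dinv; rewrite opprK.
    have H := @is_derive1_comp R expR (fun y =>
        - y^-1) x _ _ (is_derive_expR _) dn.
    by apply: is_derive_eq H _; rewrite exprVn mulrC.
  have H := is_deriveM (dpow j) dexp.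
  apply: (near_eq_is_derive (f :=
    (fun y : R => y^-1 ^+ j) * (fun y => expR (- y^-1)))).
    by near=> y; rewrite /flat ifT //; near: y; exact: lt_nbhsr.
  apply: is_derive_eq H _; rewrite /flat x0.
  have scE (a b : R) : a *: (b : R^o) = a * b by [].
  by rewrite !scE !exprS; ring.
- rewrite !flat_eq0 // mulr0 subr0.
  have H : (fun h => h^-1 *: ((flat j \o shift 0) (h *: 1) - flat j 0)) @ (0 :
      R)^' --> (0 : R).
    apply/cvgrPdist_le => e e0.
    pose C : R := (j.+2)`!%:R; have C0 : 0 < C by rewrite ltr0n fact_gt0.
    near=> h; have h0 : h != 0 by near: h; exact: nbhs_dnbhs_neq.
    have -> : h^-1 *: ((flat j \o shift 0) (h *: 1) - flat j 0) = flat j.+1 h.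
      rewrite /= [h *: 1]mulr1 addr0 (flat_eq0 _ (lexx 0)) subr0.
      have [hp|hn] := ltP 0 h; last by rewrite !flat_eq0 // [LHS]mulr0.
      by rewrite /flat hp exprS -mulrA.
    rewrite sub0r normrN (le_trans (flat_bound _ _)) // -ler_pdivlMl //.
    by near: h; apply: dnbhs0_le; rewrite mulr_gt0 // invr_gt0.
  by split; [apply/cvg_ex; exists 0|exact: cvg_lim H].
Unshelve. all: by end_near. Qed.

Lemma flat_Ck k j (U : set R) : Ck k U (flat j).
Proof.
apply: (@Ck_sub _ _ _ k setT) => //.
elim: k j => [|k IH] j; have cj : forall x, setT x ->
  {for x, continuous (flat j)}.
- move=> x _; apply: differentiable_continuous; apply/derivable1_diffP.
  by have [] := flat_derive j x.
- by split.
- move=> x _; apply: differentiable_continuous; apply/derivable1_diffP.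
  by have [] := flat_derive j x.
have df x : differentiable (flat j) x.
  by apply/derivable1_diffP; have [] := flat_derive j x.
split=> // v; split; first by move=> x _; exact: diff_derivable.
have H : Ck k setT (fun x => v * (flat j.+2 x + (- j%:R) * flat j.+1 x)).
  apply: CkM; [exact: openT|exact: Ck_cst|].
  apply: CkD; [exact: openT|exact: IH|].
  by apply: CkM; [exact: openT|exact: Ck_cst|exact: IH].
apply: Ck_eq H; first exact: openT.
move=> x _; rewrite deriveE // -[X in 'd _ _ X]mulr1.
have -> : v * 1 = v *: (1 : R) by [].
by rewrite linearZ -deriveE // (@derive_val _ _ _ _ _ _ _ (flat_derive j x))
  mulNr.
Qed.

(** The arguments 2 - x^2 and x^2 - 1 add up to 1, so one of them is
    positive and the denominator never vanishes. *)
Definition plateau (x : R) : R :=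
  flat 0 (2 - x ^+ 2) / (flat 0 (2 - x ^+ 2) + flat 0 (x ^+ 2 - 1)).

Lemma plateau_eq1 x : `|x| <= 1 -> plateau x = 1.
Proof.
move=> x1; have x2 : x ^+ 2 <= 1 by rewrite -real_normK ?num_real // expr_le1.
rewrite /plateau (@flat_eq0 _ (x ^+ 2 - 1)) ?subr_le0 // addr0 divff //.
by rewrite gt_eqF // flat_gt0; lra.
Qed.

Lemma plateau_eq0 x : 2 <= `|x| -> plateau x = 0.
Proof.
move=> x2; rewrite /plateau flat_eq0 ?mul0r //.
have : 2 ^+ 2 <= `|x| ^+ 2 by rewrite lerXn2r // nnegrE.
by rewrite real_normK ?num_real // => ?; lra.
Qed.

Lemma plateau_Ck k : Ck k setT plateau.
Proof.
have sq : Ck k setT (fun x : R => x ^+ 2).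
  by apply: CkM; [exact: openT|exact: Ck_id|exact: Ck_id].
have f1 : Ck k setT (fun x : R => flat 0 (2 - x ^+ 2)).
  apply: (@Ck_comp R R R k setT setT (flat 0) (fun x => 2 - x ^+ 2)) => //.
  - exact: findim_real.
  - exact: openT.
  - exact: openT.
  - exact: flat_Ck.
  - have H : Ck k setT (fun x : R => 2 + (-1) * x ^+ 2).
      apply: CkD; [exact: openT|exact: Ck_cst|].
      by apply: CkM; [exact: openT|exact: Ck_cst|].
    by apply: Ck_eq H; [exact: openT|move=> x _; rewrite mulN1r].
have f2 : Ck k setT (fun x : R => flat 0 (x ^+ 2 - 1)).
  apply: (@Ck_comp R R R k setT setT (flat 0) (fun x => x ^+ 2 - 1)) => //.
  - exact: findim_real.
  - exact: openT.
  - exact: openT.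
  - exact: flat_Ck.
  - by apply: CkD; [exact: openT| |exact: Ck_cst].
apply: CkM => //; first exact: openT.
apply: CkV; [exact: openT| |by apply: CkD => //; exact: openT].
move=> x _; rewrite gt_eqF //.
have [h|h] := ltP (x ^+ 2) 2.
  by rewrite ltr_pwDl ?flat_ge0 // flat_gt0 // subr_gt0.
by rewrite ltr_wpDl ?flat_ge0 // flat_gt0; lra.
Qed.

End FlatFunction.

(** * Bump functions and coordinate fields *)

Section SmoothOnManifold.
Context {R : realType} {n : nat} {M : manifold R n}.
Implicit Types (c : chart M 'rV[R]_n) (p q : M) (W : normedModType R).

Let atp p : atlas (chart_at p) := @atlas_chart_at _ _ M p.
Let mem p : cdom (chart_at p) p := @mem_chart_at _ _ M p.

(** Stated in every chart around p to avoid changes of charts; one chart is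
    enough for scalar functions. *)
Definition smooth_at W (f : M -> W) p : Prop := forall c, atlas c -> cdom c p ->
  smooth_germ (chart_image c) (f \o cinv c) (cmap c p).

Lemma unit0 : 0 <= (0 : R) <= 1.
Proof. by rewrite lexx ler01. Qed.

Lemma smooth_at_chart c (f : M -> R) p : atlas c -> cdom c p ->
  smooth_germ (chart_image c) (f \o cinv c) (cmap c p) -> smooth_at f p.
Proof.
move=> ac cp sf c' ac' c'p.
have := family_germ_change ac ac' cp c'p unit0 (family_germ_static 0 sf).
exact: family_germ_slice unit0.
Qed.

Lemma smooth_at_family_germ W c (f : M -> W) t p : atlas c -> cdom c p ->
    smooth_at f p ->
  family_germ c (fun=> f) t p.
Proof. by move=> ac cp sf; apply: family_germ_static; exact: sf. Qed.

Lemma smooth_at_mdiff (f : M -> R) p : smooth_at f p -> differentiable_at f p.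
Proof.
by move=> /(smooth_at_family_germ 0 (atp p) (mem p));
  exact: family_germ_mdiff unit0.
Qed.

Lemma smooth_at_near W (f g : M -> W) p : (\forall q \near p, f q = g q) ->
  smooth_at f p -> smooth_at g p.
Proof.
move=> fg sf c ac cp; apply: smooth_germ_near (sf c ac cp).
by have := near_cinv ac cp fg; apply: filterS => y.
Qed.

Lemma smooth_at_nbhs (f : M -> R) p : smooth_at f p ->
    \forall q \near p, smooth_at f q.
Proof.
move=> /(_ _ (atp p) (mem p)) /smooth_germ_nbhs /(near_cmap (atp p) (mem p)) h.
apply: filterS2 h (near_cdom (atp p) (mem p)) => q h cq.
exact: (smooth_at_chart (atp p) cq).
Qed.

Lemma smooth_atM (f g : M -> R) p : smooth_at f p -> smooth_at g p ->
    smooth_at (fun q => f q * g q) p.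
Proof. by move=> sf sg c ac cp; apply: smooth_germM; [exact: sf|exact: sg]. Qed.

Lemma smooth_at_cst W (a : W) p : smooth_at (fun=> a) p.
Proof. by move=> c ac cp; exact: smooth_germ_cst. Qed.

Lemma smooth_at_coord m (f : M -> 'rV[R]_m) p i : smooth_at f p ->
    smooth_at (fun q => f q 0 i) p.
Proof. by move=> sf c ac cp; exact: (smooth_germ_coord 0 i (sf c ac cp)). Qed.

Lemma smooth_at_rV m (f : M -> 'rV[R]_m) p :
  (forall i, smooth_at (fun q => f q 0 i) p) -> smooth_at f p.
Proof. by move=> h c ac cp; apply: smooth_germ_rV => i;
  exact: (h i c ac cp). Qed.

Lemma smooth_at_cmap c p : atlas c -> cdom c p -> smooth_at (cmap c) p.
Proof. by move=> ac cp c' ac' c'p; exact: transition_smooth_germ. Qed.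

Lemma smooth_at_derive c (f : M -> R) p v : atlas c -> cdom c p ->
    smooth_at f p ->
  smooth_at (fun q => 'D_v (f \o cinv c) (cmap c q)) p.
Proof.
move=> ac cp sf; apply: (smooth_at_chart ac cp).
have := family_germ_derive v ac cp (smooth_at_family_germ 0 ac cp sf).
exact: family_germ_slice unit0.
Qed.

Lemma smooth_fun_onP W (D : set M) (f : M -> W) : open D ->
  (forall p, D p -> smooth_at f p) <-> smooth_fun_on D f.
Proof.
move=> oD; split=> h.
  move=> c ac y [p [cp Dp] <-]; apply: smooth_germ_near (h p Dp c ac cp).
  near=> z; move=> [q [cq Dq] <-]; split => //; exact: image_cmap.
move=> p Dp c ac cp.
have sA : smooth_germ (cmap c @` (cdom c `&` D)) (f \o cinv c) (cmap c p).
  by apply: h => //; exists p.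
apply: smooth_germ_near sA.
have := near_cinv ac cp (open_nbhs_nbhs (conj oD Dp)).
apply: filterS => y Dy iy; split => //; exists (cinv c y); last exact: cinvK.
by split => //; exact: cdom_cinv.
Unshelve. all: by end_near. Qed.

(** The function is a product of plateaus of the coordinates, supported in
    the preimage K of a closed ball of a chart. As M is Hausdorff, the
    compact set K is closed, so that continuing by 0 keeps smoothness. *)
Lemma bump_function (O : set M) p : open O -> O p ->
  exists (chi : M -> R) (K : set M), [/\ closed K, K `<=` O,
    forall q, ~ K q -> chi q = 0, \forall q \near p, chi q = 1 &
    forall q, smooth_at chi q].
Proof.
move=> oO Op; pose c := chart_at p; pose x := cmap c p.
have nO : \forall y \near x, chart_image c y /\ O (cinv c y).
  apply: filterI; first exact: (near_image (atp p) (mem p)).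
  by apply: (near_cinv (atp p) (mem p)); exact: open_nbhs_nbhs.
have [r hr] := (nbhs_closedballP _ _).1 nO.
pose B := closed_ball x r%:num; pose K := cinv c @` B.
(* The factor 2 / r sends the ball of radius r / 2 into [-1, 1] and a
   coordinate larger than r out of ]-2, 2[. *)
pose scale (q : M) i : R := 2 / r%:num * (cmap c q 0 i - x 0 i).
pose chi (q : M) : R := if pselect (cdom c q) then \prod_i plateau (scale q i)
  else 0.
have cB : compact B.
  apply: bounded_closed_compact; last exact: closed_ball_closed.
  exists (`|x| + r%:num); split; first by rewrite num_real.
  move=> C hC y; rewrite /B closed_ballE //= /closed_ball_ /= => yx.
  rewrite -(subKr x y) (le_trans (ler_normB _ _)) // ltW //.
  by apply: le_lt_trans hC; rewrite lerD2l.
have cK : closed K.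
  apply: compact_closed; first exact: manifold_hausdorff.
  apply: continuous_compact => //.
  apply: continuous_in_subspaceT => y; rewrite inE => /hr [iy _].
  exact: (cinv_continuous (atp p) iy).
have chiK q : ~ K q -> chi q = 0.
  rewrite /chi; case: pselect => // cq nK.
  have [i hi] : exists i, r%:num < `|(x - cmap c q) 0 i|.
    apply/not_existsP => H; apply: nK; exists (cmap c q);
      last exact: (cmapK (atp p) cq).
    rewrite /B closed_ballE //= /closed_ball_ /=.
    rewrite [leLHS]/Num.Def.normr/= mx_normrE (bigmax_le _ _)//= => -[i j] _ /=.
    by rewrite ord1 leNgt; apply/negP; exact: H.
  rewrite (bigD1 i) //= plateau_eq0 ?mul0r //.
  rewrite /scale normrM gtr0_norm ?divr_gt0 // -mulrA.
  rewrite ler_peMr // ler_pdivlMl // mulr1 distrC.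
  by move: hi; rewrite !mxE => /ltW.
exists chi, K; split => //.
- by move=> q [y /hr [_ Oy] <-].
- have : \forall y \near x, `|x - y| <= r%:num / 2.
    by have /cvgrPdist_le := @cvg_id _ (nbhs x); apply; rewrite divr_gt0.
  move=> /(near_cmap (atp p) (mem p)) h.
  apply: filterS2 h (near_cdom (atp p) (mem p)) => q hq cq.
  rewrite /chi; case: pselect => [?|ncq]; last by case: (ncq cq).
  rewrite big1 // => i _.
  apply: plateau_eq1; rewrite /scale normrM gtr0_norm ?divr_gt0 //.
  rewrite mulrAC ler_pdivrMr // mul1r -ler_pdivlMl // mulrC.
  apply: le_trans hq; rewrite distrC.
  by have := ler_mx_norm (x - cmap c q) 0 i; rewrite !mxE.
- move=> q; have [Kq|nKq] := pselect (K q); last first.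
    apply: (smooth_at_near (f := fun=> 0)); last exact: smooth_at_cst.
    have oK : open (~` K) by exact: closed_openC.
    have := open_nbhs_nbhs (conj oK nKq).
    by apply: filterS => q' /chiK ->.
  have cq : cdom c q by have [y /hr [iy _] <-] := Kq;
      exact: (cdom_cinv (atp p) iy).
  apply: (smooth_at_near (f := fun q => \prod_i plateau (scale q i))).
    apply: filterS (near_cdom (atp p) cq) => q' cq'.
    by rewrite /chi; case: pselect => // ncq; case: (ncq cq').
  apply: (@smooth_at_chart c) => //; first exact: atp.
  have sp i : smooth_germ (chart_image c) ((fun q =>
      plateau (scale q i)) \o cinv c) (cmap c q).
    apply: (@smooth_germ_comp R 'rV[R]_n R _ setT plateau
      (fun y => scale (cinv c y) i)) => //.
    - exact: findim_real.
    - exact: image_cmap.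
    - by exists setT, plateau; split => // [|k];
      [exact: openT|exact: plateau_Ck].
    - have H : smooth_germ (chart_image c) (fun y : 'rV[R]_n =>
      2 / r%:num * (y 0 i + - x 0 i)) (cmap c q).
        apply: smooth_germM; first exact: smooth_germ_cst.
        apply: smooth_germD; last exact: smooth_germ_cst.
        apply: (@smooth_germ_coord _ _ _ _ _ (fun y => y)).
        by exists setT, id; split => // [|k]; [exact: openT|exact: Ck_id].
      apply: smooth_germ_eq H => y iy; split => //.
      by rewrite /scale (cinvK (atp p)).
  have : forall s : seq 'I_n, smooth_germ (chart_image c)
     (fun y => \prod_(i <- s) plateau (scale (cinv c y) i)) (cmap c q).
    elim=> [|i s IH].
      by under eq_fun do rewrite big_nil; exact: smooth_germ_cst.
    by under eq_fun do rewrite big_cons; apply: smooth_germM;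
      [exact: sp|exact: IH].
  exact.
Qed.

(** Poisson tensors satisfy the Jacobi identity on global functions;
    extending germs makes it available for coordinates. *)
Lemma smooth_extension (f : M -> R) p : smooth_at f p ->
  exists g : M -> R, (forall q, smooth_at g q) /\ (\forall q \near p,
    g q = f q).
Proof.
move=> sf.
have [|chi [K [cK KO chi0 chi1 schi]]] :=
  @bump_function [set q | smooth_at f q]° p (@open_interior _ _).
  exact: smooth_at_nbhs.
exists (fun q => chi q * f q); split; last first.
  by apply: filterS chi1 => q ->; rewrite mul1r.
move=> q; have [Kq|nKq] := pselect (K q).
  by apply: smooth_atM => //; have := KO q Kq; exact: interior_subset.
apply: (smooth_at_near (f := fun=> 0)); last exact: smooth_at_cst.
have oK : open (~` K) by exact: closed_openC.
have := open_nbhs_nbhs (conj oK nKq).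
by apply: filterS => q' /chi0 ->; rewrite mul0r.
Qed.

(** The vector on the left is the coordinate field of c, written in the
    frame of chart_at q. *)
Lemma tangent_coordinate_vector W c (f : M -> W) q v : atlas c -> cdom c q ->
  differentiable_at f q ->
  tangent_fun f q ('D_v (cmap (chart_at q) \o cinv c) (cmap c q)) =
  'D_v (f \o cinv c) (cmap c q).
Proof.
move=> ac cq df; have dfc := (mdiff_chart f ac cq).1 df.
rewrite {1}/tangent_fun deriveE //.
have dt := transition_differentiable ac (atp q) cq (mem q).
rewrite -(near_eq_derive _ (near_transition f (atp q) ac (mem q) cq)).
have df' : differentiable (f \o cinv (chart_at q))
    ((cmap (chart_at q) \o cinv c) (cmap c q)) by rewrite /= cmapK.
have [_ ->] := derive_comp df' (diff_derivable (v := v) dt).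
by rewrite /= cmapK.
Qed.

(** Connections and forms on B are tested on global fields, hence the
    coordinate fields are cut off by a bump function. The bump equals 1 near
    p, so the brackets still vanish there. *)
Lemma coordinate_fields p : exists u : 'I_n -> M -> 'rV[R]_n,
  [/\ forall i, vector_field (u i),
      forall i, u i p = delta_mx 0 i,
      forall i, \forall q \near p,
        lie_fun (u i) (cmap (chart_at p)) q = delta_mx 0 i &
      forall i j, lie_bracket (u i) (u j) p = 0].
Proof.
pose d := chart_at p.
have [chi [K [cK KO chi0 chi1 schi]]] :=
  bump_function (cdom_open (atp p)) (mem p).
pose u i q := chi q *: 'D_(delta_mx 0 i) (cmap (chart_at q) \o cinv d) (cmap d
  q)
  : 'rV[R]_n.
have lieu W i (f : M -> W) q : cdom d q -> differentiable_at f q ->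
    lie_fun (u i) f q = chi q *: 'D_(delta_mx 0 i) (f \o cinv d) (cmap d q).
  move=> dq df; rewrite /lie_fun -(tangent_coordinate_vector _ (atp p) dq df).
  rewrite /tangent_fun (deriveE _ df) (deriveE _ df).
  by rewrite /u linearZ.
have lieu1 : forall i, \forall q \near p,
    lie_fun (u i) (cmap d) q = delta_mx 0 i.
  move=> i.
  apply: filterS2 chi1 (near_cdom (atp p) (mem p)) => q chiq dq.
  rewrite lieu //; last exact: (mdiff_cmap (atp p) dq).
  rewrite chiq scale1r -[RHS](@derive_id R 'rV[R]_n (cmap d q)).
  apply: near_eq_derive; have := near_image (atp p) dq.
  by apply: filterS => y /=; exact: (cinvK (atp p)).
exists u; split => //.
- move=> i c ac; apply/smooth_fun_onP; first exact: cdom_open.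
  move=> q cq; have [Kq|nKq] := pselect (K q); last first.
    apply: (smooth_at_near (f := fun=> 0)); last exact: smooth_at_cst.
    have oK : open (~` K) by exact: closed_openC.
    have := open_nbhs_nbhs (conj oK nKq).
    apply: filterS => q' /chi0 chiq'.
    by rewrite /lie_fun /tangent_fun /u chiq' scale0r derive0.
  have dq := KO q Kq; apply: smooth_at_rV => j.
  apply: (smooth_at_near (f := fun q => chi q *
      'D_(delta_mx 0 i) (chart_coord c j \o cinv d) (cmap d q))).
    apply: filterS2 (near_cdom (atp p) dq) (near_cdom ac cq) => q' dq' cq'.
    rewrite lieu //; last exact: mdiff_cmap.
    rewrite mxE derive_mx ?mxE //; apply: diff_derivable.
    exact: (transition_differentiable (atp p) ac dq' cq').
  apply: smooth_atM => //; apply: (smooth_at_derive _ (atp p) dq).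
  exact: (smooth_at_coord j (smooth_at_cmap ac cq)).
- move=> i; rewrite /u (nbhs_singleton chi1) scale1r.
  rewrite -[RHS](@derive_id R 'rV[R]_n (cmap d p)).
  apply: near_eq_derive; have := near_image (atp p) (mem p).
  by apply: filterS => y /=; exact: (cinvK (atp p)).
- move=> i j; rewrite /lie_bracket.
  have H a b : lie_fun (u a) (lie_fun (u b) (cmap (chart_at p))) p = 0.
    rewrite {1}/lie_fun (tangent_near _ (g := fun=> delta_mx 0 b)) //.
    by rewrite /tangent_fun derive_cst.
  by rewrite !H subrr.
Qed.

End SmoothOnManifold.

(** * The projection of a fiber bundle *)

Section ChainRule.
Context {R : realType} {n m : nat} {M : manifold R n} {N : manifold R m}.

Let atM p : atlas (chart_at p) := @atlas_chart_at _ _ M p.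
Let memM p : cdom (chart_at p) p := @mem_chart_at _ _ M p.
Let atN p : atlas (chart_at p) := @atlas_chart_at _ _ N p.
Let memN p : cdom (chart_at p) p := @mem_chart_at _ _ N p.

Lemma tangent_fun_comp (W : normedModType R) (h : M -> N) (f : N ->
    W) (p : M) v :
  {for p, continuous h} -> differentiable_at (cmap (chart_at (h p)) \o h) p ->
    differentiable_at f (h p) ->
  differentiable_at (f \o h) p /\
  tangent_fun (f \o h) p v = tangent_fun f (h p) (tangent_map h p v).
Proof.
move=> ch dh df; pose d := chart_at (h p); pose c := chart_at p.
have nh : {near cmap c p,
    (f \o cinv d) \o (cmap d \o h \o cinv c) =1 f \o h \o cinv c}.
  have := near_cinv (atM p) (memM p) (ch _ (near_cdom (atN _) (memN (h p)))).
  by apply: filterS => y /= hy; rewrite (cmapK (atN _)).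
have df' : differentiable (f \o cinv d) ((cmap d \o h \o cinv c) (cmap c p)).
  by rewrite /= (cmapK (atM p)).
have dc : differentiable ((f \o cinv d) \o (cmap d \o h \o cinv c)) (cmap c p).
  exact: differentiable_comp.
split; first by have [] := near_eq_differentiable nh dc.
rewrite /tangent_fun -(near_eq_derive _ nh).
have [_ ->] := derive_comp df' (diff_derivable (v := v) dh).
by rewrite -deriveE // /= (cmapK (atM p)).
Qed.

End ChainRule.

Section FiberBundle.
Context {R : realType} {n m k : nat} {E : manifold R n} {B : manifold R m}.
Context {Fib : manifold R k}.
Variable pi : E -> B.
Hypothesis hpi : fiber_bundle Fib pi.

Let atE p : atlas (chart_at p) := @atlas_chart_at _ _ E p.
Let memE p : cdom (chart_at p) p := @mem_chart_at _ _ E p.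
Let atB p : atlas (chart_at p) := @atlas_chart_at _ _ B p.
Let memB p : cdom (chart_at p) p := @mem_chart_at _ _ B p.

Lemma projection_continuous (e : E) : {for e, continuous pi}.
Proof.
have [[+ _] _] := hpi; rewrite continuous_open_subspace; last exact: openT.
by move=> /(_ e); apply; rewrite inE.
Qed.

Lemma projection_smooth_at d e : atlas d -> cdom d (pi e) ->
    smooth_at (cmap d \o pi) e.
Proof.
move=> ad de c ac ce; have [[_ sp] _] := hpi.
pose D := cdom c `&` setT `&` pi @^-1` cdom d.
have H : smooth_germ (cmap c @` D) (cmap d \o pi \o cinv c) (cmap c e).
  by apply: sp => //; exists e.
apply: smooth_germ_near H.
have := near_cinv ac ce (projection_continuous (near_cdom ad de)).
apply: filterS => y dy iy; split => //; exists (cinv c y); last exact: cinvK.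
by split => //; split => //; exact: cdom_cinv.
Qed.

Lemma projection_mdiff d e : atlas d -> cdom d (pi e) ->
    differentiable_at (cmap d \o pi) e.
Proof.
move=> ad de; apply: mdiff_rV => j; apply: smooth_at_mdiff.
exact: (smooth_at_coord j (projection_smooth_at ad de)).
Qed.

Definition projection_jacobian (e : E) : 'M[R]_(n,
    m) := \matrix_i tangent_map pi e (delta_mx 0 i).

Lemma tangent_mapE e v : tangent_map pi e v = v *m projection_jacobian e.
Proof.
have dp := projection_mdiff (atB _) (memB (pi e)).
rewrite /tangent_map /tangent_fun deriveE // {1}(row_sum_delta v) linear_sum.
rewrite {2}(row_sum_delta v) mulmx_suml; apply: eq_bigr => i _.
rewrite linearZ -scalemxAl -rowE rowK /tangent_map /tangent_fun.
by rewrite (deriveE _ dp).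
Qed.

Lemma dfun_projection (f : B -> R) e : differentiable_at f (pi e) ->
  dfun (f \o pi) e = projection_jacobian e *m dfun f (pi e).
Proof.
move=> df; have dp := projection_mdiff (atB _) (memB (pi e)).
apply/matrixP => i j; rewrite !mxE.
have [_ ->] := tangent_fun_comp (delta_mx 0 i) (projection_continuous (e :=
    e)) dp df.
rewrite tangent_dfun // mxE; apply: eq_bigr => a _.
by rewrite (ord1 j) /projection_jacobian [X in _ = X * _]mxE.
Qed.

(** Through e passes the local section b |-> s (b, tau e); differentiating
    pi o section = id exhibits the preimage of w. *)
Lemma tangent_map_surjective e w : exists v, tangent_map pi e v = w.
Proof.
have [_ /(_ (pi e)) [U [tau [s [[oU Ue] _ [cs ss] sE sP]]]]] := hpi.
pose f0 := tau e; pose b0 := pi e.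
have se : s (b0, f0) = e by exact: sE.
pose d := chart_at b0; pose df := chart_at f0; pose c := chart_at e.
have atF : atlas df by exact: atlas_chart_at.
have memF : cdom df f0 by exact: mem_chart_at.
pose y0 := cmap d b0; pose w0 := cmap df f0.
pose D := cdom (prod_chart d df) `&` (U `*` setT) `&` s @^-1` cdom c.
have [Z [g [oZ Zz sg gf]]] : smooth_germ (cmap (prod_chart d df) @` D)
    (cmap c \o s \o cinv (prod_chart d df)) (y0, w0).
  apply: ss; [by exists d, df; split => //; exact: atB|exact: atE|].
  exists (b0, f0) => //; split; first by split => //; split => //; exact: memB.
  by rewrite /= se; exact: memE.
have csz : {for (b0, f0), continuous s}.
  move: cs; rewrite continuous_open_subspace; last first.
    by rewrite openE => -[b f] /= [Ub _]; exists (U, setT) => //=; split;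
      [exact: open_nbhs_nbhs|exact: filterT].
  by move=> /(_ (b0, f0)); apply; rewrite inE.
pose sigma y := g (y, w0).
have nsig : \forall y \near y0,
    chart_image d y /\ sigma y = cmap c (s (cinv d y, f0))
    /\ cdom c (s (cinv d y, f0)) /\ U (cinv d y).
  have n1 : \forall y \near y0, cdom c (s (cinv d y, f0)).
    have : \forall b \near b0, cdom c (s (b, f0)).
      have : \forall z \near (b0, f0), cdom c (s z).
        by apply: csz; rewrite se; exact: (near_cdom (atE _) (memE _)).
      exact: (@pair_continuousl B Fib f0 b0).
    exact: (near_cinv (atB _) (memB _)).
  have n2 : \forall y \near y0, U (cinv d y).
    exact: (near_cinv (atB _) (memB _) (open_nbhs_nbhs (conj oU Ue))).
  have n3 : \forall y \near y0, Z (y, w0).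
    have : \forall z \near (y0, w0), Z z by exact: open_nbhs_nbhs.
    exact: (@pair_continuousl 'rV[R]_m 'rV[R]_k w0 y0).
  have n4 := near_image (atB _) (memB b0).
  near=> y; have iy : chart_image d y by near: y.
  have Uy : U (cinv d y) by near: y.
  have cy : cdom c (s (cinv d y, f0)) by near: y.
  split=> //; split=> //; rewrite /sigma gf //=.
  - by rewrite (cmapK atF).
  - exists (cinv d y, f0); last by rewrite /= (cinvK (atB _)).
    split => //; split => //; split => //=; exact: (cdom_cinv (atB _)).
  - by near: y.
have sigma0 : sigma y0 = cmap c e.
  by have [_ [-> _]] := nbhs_singleton nsig; rewrite (cmapK (atB _)) // se.
have dsig : derivable sigma y0 w.
  have : Ck 1 [set y | Z (y, w0)] (g \o (fun y => (y, w0))).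
    apply: (@Ck_affine R _ _ _ 1 Z _ g (fun y : 'rV[R]_m => (y,
      w0 : 'rV[R]_k)) (fun v => (v, 0))) => //.
    - exact: pair_continuousl.
    - by move=> h v y; congr (_, _);
      exact: (esym (etrans (congr1 (+%R^~ w0) (scaler0 _ h)) (add0r _))).
  by move=> [_ /(_ w) [+ _]]; apply.
exists ('D_w sigma y0).
have dp : differentiable (cmap d \o pi \o cinv c) (sigma y0).
  by rewrite sigma0; exact: (projection_mdiff (atB _) (memB (pi e))).
have [_ H] := derive_comp dp dsig.
rewrite /tangent_map /tangent_fun -/c -/d -sigma0 deriveE // -H.
rewrite -[RHS](@derive_id R 'rV[R]_m y0); apply: near_eq_derive.
apply: filterS nsig => y [iy [sy [cy Uy]]].
change (cmap d (pi (cinv c (sigma y))) = y).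
by rewrite sy (cmapK (atE _)) // (sP _ f0 Uy).1 (cinvK (atB _)).
Unshelve. all: by end_near. Qed.

End FiberBundle.

(** * Linear algebra of coupling tensors *)

Section CouplingAlgebra.
Context {R : realType} {n m : nat}.
Implicit Types (P Ups : 'M[R]_n) (A : 'M[R]_(n, m)) (F : 'M[R]_m).

(** For A the matrix of d pi at a point, gram P A consists of the brackets
    of base coordinates, and the rows of lift P A are the horizontal lifts
    of the coordinate fields. *)
Definition gram P A : 'M[R]_m := A^T *m P *m A.
Definition lift P A : 'M[R]_(m, n) := invmx (gram P A) *m A^T *m P.

Lemma gram_skew P A : P^T = - P -> (gram P A)^T = - gram P A.
Proof. by move=> sP; rewrite /gram !trmx_mul trmxK sP mulNmx mulmxN mulmxA. Qed.

Lemma mulmx_eq_cV p (M N : 'M[R]_(n, p)) :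
  (forall a : 'cV[R]_n, a^T *m M = a^T *m N) -> M = N.
Proof.
move=> h; apply/row_matrixP => i; rewrite !rowE.
by have := h (delta_mx i 0); rewrite trmx_delta.
Qed.

(** For every v the vector v - v A S is killed by A, hence by a. *)
Lemma annihilator_range (A : 'M[R]_(n, m)) (S : 'M[R]_(m, n)) (a : 'cV[R]_n) :
  S *m A = 1%:M -> (forall v : 'rV[R]_n, v *m A = 0 -> v *m a = 0) ->
  a = A *m (S *m a).
Proof.
move=> SA h; apply: mulmx_eq_cV => b.
have := h (b^T - b^T *m A *m S).
rewrite !mulmxBl -[_ *m S *m A]mulmxA SA mulmx1 subrr => /(_ erefl) /eqP.
by rewrite subr_eq0 -!mulmxA => /eqP.
Qed.

Lemma unitmx_surjective (K : 'M[R]_m) :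
  (forall w : 'rV[R]_m, exists c : 'rV[R]_m, c *m K = w) -> K \in unitmx.
Proof.
move=> h; rewrite -row_full_unit -sub1mx; apply/row_subP => i.
have [c <-] := h (row i 1%:M); exact: submxMl.
Qed.

Section Coupling.
Variables (P Ups : 'M[R]_n) (A : 'M[R]_(n, m)) (F : 'M[R]_m).
Let K := gram P A.
Let H := lift P A.

Lemma mulmx_gram_lift : K \in unitmx -> K *m H = A^T *m P.
Proof.
move=> uK; have HE : H = invmx K *m (A^T *m P) by rewrite mulmxA.
by rewrite HE (mulKVmx uK).
Qed.

Lemma lift_mulmx : K \in unitmx -> H *m A = 1%:M.
Proof.
move=> uK; have HE : H *m A = invmx K *m K by rewrite /K /gram !mulmxA.
by rewrite HE (mulVmx uK).
Qed.

Lemma tr_lift : P^T = - P -> K \in unitmx -> H^T *m K = P *m A.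
Proof.
move=> sP uK; apply: trmx_inj; rewrite [in LHS]trmx_mul trmxK [in RHS]trmx_mul.
by rewrite gram_skew // sP mulNmx mulmx_gram_lift // mulmxN.
Qed.

End Coupling.

Lemma gram_form_inverse (K F : 'M[R]_m) : K \in unitmx ->
  K *m F *m K = - K -> K *m F = - 1%:M /\ F *m K = - 1%:M.
Proof.
move=> uK KFK; split; first by rewrite -[LHS](mulmxK uK) KFK mulNmx mulmxV.
by rewrite -[LHS](mulKmx uK) [K *m _]mulmxA KFK mulmxN mulVmx.
Qed.

(** Invariance at one point, once all data are expressed through H, K and
    the differentials Dd of the components of the time derivative of Q. The
    Lie derivative (first two terms) and Pd expand into the same four
    monomials x1, ..., x4 with opposite signs. *)
Lemma generator_algebra (P Pd Ups : 'M[R]_n) (A Dd : 'M[R]_(n, m))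
    (H Hd : 'M[R]_(m, n)) (K Kd F Fd : 'M[R]_m) :
  P^T = - P -> Ups^T = - Ups -> K^T = - K -> K \in unitmx ->
  K *m H = A^T *m P -> K *m F *m K = - K ->
  P = Ups + H^T *m K *m H ->
  Pd = (Hd^T *m K + H^T *m Kd) *m H + H^T *m K *m Hd ->
  (Kd *m F + K *m Fd) *m K + K *m F *m Kd = - Kd ->
  Hd = Dd^T *m Ups ->
  Fd = - (H *m Dd - (H *m Dd)^T) ->
  (A^T *m P)^T *m (Dd^T *m P) - (Dd^T *m P)^T *m (A^T *m P) + Pd = 0.
Proof.
move=> sP sU sK uK KH KFK PE PdE KdE HdE FdE.
have [KF FK] := gram_form_inverse uK KFK.
have {}KdE : Kd = K *m Fd *m K.
  move: KdE; rewrite KF mulNmx mul1mx mulmxDl -[Kd *m F *m K]mulmxA FK.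
  rewrite mulmxN mulmx1 => E.
  apply: (addIr (- Kd - Kd)).
  rewrite [LHS]addrA subrr add0r -[LHS]E.
  by rewrite addrAC addrC addrA.
have DP : Dd^T *m P = Dd^T *m Ups + Dd^T *m H^T *m K *m H.
  by rewrite {1}PE mulmxDr !mulmxA.
have PD : (Dd^T *m P)^T = - (Ups *m Dd + H^T *m K *m H *m Dd).
  by rewrite trmx_mul trmxK sP mulNmx {1}PE mulmxDl.
have HdT : Hd^T = - (Ups *m Dd) by rewrite HdE trmx_mul trmxK sU mulNmx.
rewrite -KH PD trmx_mul sK DP PdE KdE HdT HdE FdE.
rewrite trmx_mul.
rewrite !(mulmxDl, mulmxDr, mulmxN, mulNmx, opprK, opprD, mulmxBl,
  mulmxBr) !mulmxA.
set x1 := H^T *m K *m Dd^T *m Ups.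
set x2 := H^T *m K *m Dd^T *m H^T *m K *m H.
set x3 := Ups *m Dd *m K *m H.
set x4 := H^T *m K *m H *m Dd *m K *m H.
by move: x1 x2 x3 x4 => x1 x2 x3 x4; apply/matrixP => i j; rewrite !mxE; ring.
Qed.

End CouplingAlgebra.

(** * Structure of a coupling Poisson tensor *)

Section CouplingStructure.
Context {R : realType} {n m k : nat} {E : manifold R n} {B : manifold R m}.
Context {Fib : manifold R k}.
Variable pi : E -> B.
Hypothesis hpi : fiber_bundle Fib pi.
Implicit Types (P : E -> 'M[R]_n) (G : E -> set 'rV[R]_n) (F : E -> 'M[R]_m).

Lemma projection_jacobian_section e : exists S : 'M[R]_(m, n),
    S *m projection_jacobian pi e = 1%:M.
Proof.
have /choice [f hf] : forall i : 'I_m, exists v,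
    tangent_map pi e v = delta_mx 0 i.
  by move=> i; exact: tangent_map_surjective hpi e _.
exists (\matrix_i f i); apply/row_matrixP => i.
by rewrite row_mul rowK -(tangent_mapE hpi) hf rowE mulmx1.
Qed.

Lemma vertical_annihilator_jacobian e (c : 'cV[R]_m) :
  vertical_annihilator pi e (projection_jacobian pi e *m c).
Proof.
by move=> v; rewrite /vertical /= (tangent_mapE hpi) mulmxA => ->;
  rewrite mul0mx.
Qed.

Lemma horizontal_ofE P e x : horizontal_of pi P e x <->
  exists c : 'cV[R]_m, x = c^T *m (projection_jacobian pi e)^T *m P e.
Proof.
have [S SA] := projection_jacobian_section e; split=> [[a ha <-]|[c ->]].
  exists (S *m a); rewrite -trmx_mul -(annihilator_range SA) // => v.
  by rewrite -(tangent_mapE hpi); exact: ha.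
exists (projection_jacobian pi e *m c);
  first exact: vertical_annihilator_jacobian.
by rewrite /sharp trmx_mul.
Qed.

(** Complementarity provides a horizontal vector above every w, and the
    projection of a horizontal vector is in the row space of the Gram
    matrix. *)
Lemma coupling_gram P e : (P e)^T = - P e ->
  complementary (horizontal_of pi P e) (vertical pi e) ->
  gram (P e) (projection_jacobian pi e) \in unitmx.
Proof.
move=> sP [hv _]; have [S SA] := projection_jacobian_section e.
apply: unitmx_surjective => w.
have [h [v [/horizontal_ofE [c hc]]]] := hv (w *m S).
rewrite /vertical /= (tangent_mapE hpi) => vA E1.
exists c^T; rewrite /gram !mulmxA -hc.
by rewrite -[RHS]mulmx1 -SA mulmxA E1 mulmxDl vA addr0.
Qed.

Lemma horizontal_lift P e x w :
    gram (P e) (projection_jacobian pi e) \in unitmx ->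
  (horizontal_of pi P e x /\ tangent_map pi e x = w) <->
  x = w *m lift (P e) (projection_jacobian pi e).
Proof.
move=> uK; rewrite (tangent_mapE hpi); split.
  move=> [/horizontal_ofE [c ->] <-].
  rewrite -!mulmxA -(mulmx_gram_lift uK) /gram !mulmxA //.
move=> ->; split; last by rewrite -mulmxA lift_mulmx // mulmx1.
apply/horizontal_ofE; exists (w *m invmx (gram (P e) (projection_jacobian pi
  e)))^T.
by rewrite trmxK /lift !mulmxA.
Qed.

Lemma hor_lift P G (u : B ->
    'rV[R]_m) e : (forall e, G e = horizontal_of pi P e) ->
  gram (P e) (projection_jacobian pi e) \in unitmx ->
  hor pi G u e = u (pi e) *m lift (P e) (projection_jacobian pi e).
Proof.
move=> GE uK; apply/(horizontal_lift _ _ uK); rewrite -GE /hor.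
apply: (@xgetPex _ (0 : 'rV[R]_n) [set h | G e h /\ tangent_map pi e h = u (pi
  e)]).
exists (u (pi e) *m lift (P e) (projection_jacobian pi e)) => /=.
by rewrite GE; apply/(horizontal_lift _ _ uK).
Qed.

(** As PV is vertical, A^T PV = 0. Evaluating the relation
    that defines F on the covectors A a and A b therefore gives K = K F K^T,
    and skewness of K does the rest. The last identity holds because (P -
    PV)^sharp a is horizontal, hence the lift of its projection. *)
Lemma coupling_structure P PV G F e : geometric_data pi P PV G F ->
  let A := projection_jacobian pi e in let K := gram (P e) A in let H :=
    lift (P e) A in
  [/\ (P e)^T = - P e, (PV e)^T = - PV e, K \in unitmx,
      K *m F e *m K = - K & P e = PV e + H^T *m K *m H].
Proof.
move=> [[[[sP _] _] cP] GE [[sPV _] PVG] [_ uF] hF] /=.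
have uK := coupling_gram (sP e) (cP e).
have [PVv Ph] := PVG e.
have PVA : PV e *m projection_jacobian pi e = 0.
  apply: mulmx_eq_cV => a; rewrite mulmx0.
  by have := PVv a; rewrite /vertical /= (tangent_mapE hpi) /sharp mulmxA.
have APV : (projection_jacobian pi e)^T *m PV e = 0.
  by apply: trmx_inj; rewrite trmx_mul trmxK sPV mulNmx PVA oppr0 trmx0.
split=> //.
  set A := projection_jacobian pi e.
  have AP : A^T *m (P e - PV e) = A^T *m P e by rewrite mulmxBr APV subr0.
  have KE : gram (P e) A = gram (P e) A *m F e *m (gram (P e) A)^T.
    apply: mulmx_eq_cV => a; apply: trmx_inj; apply: mulmx_eq_cV => b.
    apply: trmx_inj.
    have := hF e (A *m a) (A *m b) (@vertical_annihilator_jacobian e a)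
      (@vertical_annihilator_jacobian e b).
    rewrite /bivector_at /pullback2 /sharp !(tangent_mapE hpi) -/A.
    rewrite [(A *m a)^T]trmx_mul [(A *m b)^T]trmx_mul -!(mulmxA _ A^T) AP => H0.
    have e1 (X : 'M[R]_m) : (b^T *m (a^T *m X)^T)^T = a^T *m X *m b.
      by rewrite trmx_mul !trmxK.
    rewrite !e1; apply/matrixP => i j; rewrite !ord1.
    have -> : a^T *m gram (P e) A *m b = a^T *m (A^T *m P e) *m (A *m b).
      by rewrite /gram !mulmxA.
    rewrite H0; congr (fun_of_matrix _ 0 0).
    have -> : b^T *m (A^T *m P e) *m A = b^T *m gram (P e) A.
      by rewrite /gram !mulmxA.
    have -> : a^T *m (A^T *m P e) *m A = a^T *m gram (P e) A.
      by rewrite /gram !mulmxA.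
    by rewrite trmx_mul trmxK -!mulmxA.
  by rewrite [in RHS]KE gram_skew // mulmxN opprK.
apply/eqP; rewrite addrC -subr_eq; apply/eqP.
set H := lift _ _; apply: mulmx_eq_cV => a.
have := Ph a; rewrite GE /sharp => ha.
have := (horizontal_lift _ _ uK).1 (conj ha erefl).
rewrite (tangent_mapE hpi) -(mulmxA a^T) mulmxBl PVA subr0 => ->.
by rewrite tr_lift // mulmxA.
Qed.

End CouplingStructure.

Lemma poisson_local (R : realType) (n : nat) (M : manifold R n)
    (P : M -> 'M[R]_n) (f g h : M -> R) (p : M) :
  poisson P -> smooth_at f p -> smooth_at g p -> smooth_at h p ->
  bracket P f (bracket P g h) p + bracket P g (bracket P h f) p
  + bracket P h (bracket P f g) p = 0.
Proof.
move=> [_ jac] /smooth_extension [f' [sf ff]] /smooth_extension [g' [sg gg]].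
move=> /smooth_extension [h' [sh hh]].
have sT (q : M -> R) : (forall p, smooth_at q p) -> smooth_fun_on setT q.
  by move=> sq; exact: ((smooth_fun_onP q openT).1 (fun p _ => sq p)).
have := jac f' g' h' (sT _ sf) (sT _ sg) (sT _ sh) p.
have near2 (a a' b b' : M -> R) : (\forall q \near p, a q = a' q) ->
    (\forall q \near p, b q = b' q) ->
    \forall q \near p, bracket P a b q = bracket P a' b' q.
  move=> ha hb; apply: filterS2 (nbhs_interior ha) (nbhs_interior hb) => q.
  exact: bracket_near.
rewrite (bracket_near P ff (near2 _ _ _ _ gg hh)).
rewrite (bracket_near P gg (near2 _ _ _ _ hh ff)).
by rewrite (bracket_near P hh (near2 _ _ _ _ ff gg)).
Qed.

(** * The infinitesimal generator *)

Section Generator.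
Context {R : realType} {n m k : nat}.
Context {E : manifold R n} {B : manifold R m} {Fib : manifold R k}.
Variable pi : E -> B.
Hypothesis hpi : fiber_bundle Fib pi.
Variables (P : R -> E -> 'M[R]_n) (Ups : E -> 'M[R]_n).
Variables (Gam : R -> E -> set 'rV[R]_n) (F : R -> E -> 'M[R]_m).
Hypothesis hP : smooth_bivector_family P.
Hypothesis hdata : forall t : R, 0 <= t <= 1 ->
  geometric_data pi (P t) Ups (Gam t) (F t).
Variable Q : R -> E -> 'cV[R]_m.
Hypothesis hQ : smooth_form1_family pi Q.

Hypothesis hhor : forall t : R, 0 <= t <= 1 ->
  forall u : B -> 'rV[R]_m, vector_field u -> forall e : E,
    hor pi (Gam t) u e
    = hor pi (Gam 0) u e + sharp (Ups e) (dfun (eval1 pi (Q t) u) e).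
Hypothesis hF : forall t : R, 0 <= t <= 1 ->
  forall u0 u1 : B -> 'rV[R]_m, vector_field u0 -> vector_field u1 ->
  forall e : E,
    eval2 pi (F t) u0 u1 e
    = eval2 pi (F 0) u0 u1 e
      - (covd1 pi (Gam 0) (Q t) u0 u1 e
         + 2^-1 * wedge_bracket pi Ups (Q t) u0 u1 e).

Let atE p : atlas (chart_at p) := @atlas_chart_at _ _ E p.
Let memE p : cdom (chart_at p) p := @mem_chart_at _ _ E p.
Let atB p : atlas (chart_at p) := @atlas_chart_at _ _ B p.
Let memB p : cdom (chart_at p) p := @mem_chart_at _ _ B p.

Let A e := projection_jacobian pi e.
Let Qd t e := time_derive (fun s => Q s e) t.

(** Solution of the equation for X without inverting F: by
    coupling_structure F is minus the inverse of the Gram matrix, so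
    contracting with P undoes the contraction with F. *)
Definition generator (t : R) (e : E) : 'rV[R]_n :=
    - sharp (P t e) (A e *m Qd t e).

Let generatorE t e : 0 <= t <= 1 -> gram (P t e) (A e) \in unitmx ->
  generator t e = - ((Qd t e)^T *m gram (P t e) (A e)) *m lift (P t e) (A e).
Proof.
move=> t01 uK; rewrite /generator /sharp trmx_mul mulNmx -[in RHS]mulmxA.
by rewrite mulmx_gram_lift // mulmxA.
Qed.

Lemma generator_horizontal t e : 0 <= t <= 1 ->
  Gam t e (generator t e) /\ interior_product pi (generator t) (F t) e = Qd t e.
Proof.
move=> t01; have [_ GE _ _ _] := hdata t01.
have [sP sU uK KFK PE] := coupling_structure hpi e (hdata t01).
have [KF FK] := gram_form_inverse uK KFK.
have [Gx tx] := (horizontal_lift hpi _ _ uK).2 (generatorE t01 uK).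
rewrite GE; split => //.
by rewrite /interior_product tx mulNmx -mulmxA KF mulmxN mulmx1 opprK trmxK.
Qed.

Lemma generator_unique t (Y : E -> 'rV[R]_n) : 0 <= t <= 1 ->
  (forall e, Gam t e (Y e) /\ interior_product pi Y (F t) e = Qd t e) ->
  forall e, Y e = generator t e.
Proof.
move=> t01 hY e; have [_ GE _ _ _] := hdata t01.
have [sP sU uK KFK PE] := coupling_structure hpi e (hdata t01).
have [KF FK] := gram_form_inverse uK KFK.
have [] := hY e; rewrite GE => GY YF.
rewrite generatorE //.
apply/(horizontal_lift hpi _ _ uK); split => //.
rewrite -YF /interior_product trmxK -mulmxA FK mulmxN mulmx1 opprK //.
Qed.

Lemma eval1_family_germ c u t e : atlas c -> cdom c e -> vector_field u ->
  0 <= t <= 1 -> family_germ c (fun s => eval1 pi (Q s) u) t e.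
Proof.
move=> ac ce vu t01; apply: (family_germ_family ac ce _ t01 (hQ vu)).
exact: filterT.
Qed.

Section AtPoint.
Variable e0 : E.
Let b0 := pi e0.
Let d := chart_at b0.
Variable u : 'I_m -> B -> 'rV[R]_m.
Hypothesis vu : forall i, vector_field (u i).
Hypothesis u0 : forall i, u i b0 = delta_mx 0 i.
Hypothesis lieu : forall i, \forall b \near b0,
  lie_fun (u i) (cmap d) b = delta_mx 0 i.
Hypothesis bru : forall i j, lie_bracket (u i) (u j) b0 = 0.

(** The fields u i agree with the coordinate fields of d near b0; q i s and
    qd i s are the components of Q s and of its time derivative, and xi i
    are the base coordinates pulled back to E. *)
Let q i s := eval1 pi (Q s) (u i).
Let qd i s e := time_derive ((q i)^~ e) s.
Let xi i := chart_coord d i \o pi.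

Let good e := cdom d (pi e) /\ forall i,
    lie_fun (u i) (cmap d) (pi e) = delta_mx 0 i.

Let near_good : \forall e \near e0, good e.
Proof.
have H : \forall b \near b0, forall i, lie_fun (u i) (cmap d) b = delta_mx 0 i.
  exact: filter_forall.
have cp : {for e0, continuous pi} :=
    @projection_continuous _ _ _ _ _ _ _ _ hpi e0.
have h1 : \forall e \near e0,
    cdom d (pi e) := cp _ (near_cdom (atB _) (memB b0)).
have h2 : \forall e \near e0, forall i,
    lie_fun (u i) (cmap d) (pi e) = delta_mx 0 i
  := cp _ H.
by apply: filterS2 h1 h2 => e; split.
Qed.

(** The relation U J = 1 says that the u i are dual to the coordinates; it
    recovers Q from its components q i and hence differentiates it in time. *)
Let tder_form t e : 0 <= t <= 1 -> good e ->
  A e *m Qd t e = \sum_i qd i t e *: dfun (xi i) e.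
Proof.
move=> t01 [de hu].
pose U := \matrix_i u i (pi e);
  pose J := \matrix_(a, j) dfun (chart_coord d j) (pi e) a 0.
have UJ : U *m J = 1%:M.
  apply/matrixP => i j; have dd := mdiff_cmap (atB b0) de.
  have := congr1 (fun v : 'rV[R]_m => v 0 j) (hu i).
  rewrite /lie_fun tangent_coord // tangent_dfun; last exact: mdiff_coord.
  rewrite !mxE eqxx /= eq_sym => <-; rewrite [in RHS]/dfun.
  by apply: eq_bigr => a _; rewrite !mxE.
have JU := mulmx1C UJ.
have Qq s : Q s e = J *m \col_i q i s e.
  rewrite -[LHS]mul1mx -JU -mulmxA; congr (_ *m _); apply/colP => i.
  by rewrite !mxE /q /eval1 mxE; apply: eq_bigr => a _; rewrite !mxE.
have dQ : is_time_derive (fun s => Q s e) t (J *m \col_i qd i t e).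
  have -> : (fun s => Q s e) = (fun s => J *m \col_i q i s e) by apply/funext.
  have : is_time_derive (fun s => \col_i q i s e) t (\col_i qd i t e).
    apply: tder_mx => i j; rewrite mxE; under eq_fun do rewrite mxE.
    exact: (family_germ_tder (atE e) (memE e) t01 (eval1_family_germ (atE e)
      (memE e) (vu i) t01)).
  move=> /(tder_mulmx (tder_cst J t)); by rewrite mul0mx add0r.
rewrite /Qd (tder_lim t01 dQ).
have -> : J *m \col_i qd i t e = \sum_i qd i t e *:
    dfun (chart_coord d i) (pi e).
  apply/colP => a; rewrite mxE summxE; apply: eq_bigr => i _.
  by rewrite !mxE mulrC.
rewrite mulmx_sumr; apply: eq_bigr => i _; rewrite -scalemxAr; congr (_ *: _).
by rewrite (dfun_projection hpi (mdiff_chart_coord i (atB b0) de)).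
Qed.

(** Near e0 the generator is minus the combination with coefficients qd i of
    the Hamiltonian fields of the xi i. *)
Let lie_generator t e (f : E -> R) : 0 <= t <= 1 -> good e ->
    differentiable_at f e ->
  lie_fun (generator t) f e = \sum_i (- qd i t e) * bracket (P t) (xi i) f e.
Proof.
move=> t01 ge df; rewrite /lie_fun tangent_dfun // /generator /sharp tder_form
  //.
rewrite linear_sum /= mulmx_suml -sumrN mulmx_suml summxE;
  apply: eq_bigr => i _.
rewrite linearZ /= -scalemxAl -scaleNr -scalemxAl mxE //.
Qed.

Let xi_smooth_at i : smooth_at (xi i) e0.
Proof. exact: (smooth_at_coord i (projection_smooth_at hpi (atB b0) (memB
  b0))). Qed.

Let qd_family_germ c i t e : atlas c -> cdom c e -> 0 <= t <= 1 ->
  family_germ c (qd i) t e.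
Proof.
by move=> ac ce t01; apply: family_germ_time_derive; exact: eval1_family_germ.
Qed.

Let bracket_family_germ c t (f g : E -> R) : atlas c -> cdom c e0 ->
    0 <= t <= 1 ->
  smooth_at f e0 -> smooth_at g e0 ->
    family_germ c (fun s => bracket (P s) f g) t e0.
Proof.
move=> ac ce t01 sf sg.
by apply: family_germ_bracket => //; exact: smooth_at_family_germ.
Qed.

Lemma generator_family_germ c c' t : atlas c -> atlas c' -> cdom c e0 ->
    cdom c' e0 ->
  0 <= t <= 1 -> family_germ c' (fun s => lie_fun (generator s) (cmap c)) t e0.
Proof.
move=> ac ac' ce ce' t01; apply: family_germ_rV => j.
have H : family_germ c' (fun s e => \sum_i (-1 * qd i s e) *
    bracket (P s) (xi i) (chart_coord c j) e) t e0.
  apply: family_germ_sum => i; apply: family_germM.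
    by apply: family_germM; [exact: family_germ_cst|exact: qd_family_germ].
  apply: bracket_family_germ => //;
    exact: (smooth_at_coord j (smooth_at_cmap ac ce)).
apply: family_germ_near H => //.
apply: filterS2 near_good (near_cdom ac ce) => e ge ce1 s s01.
have dc := mdiff_cmap ac ce1.
rewrite /lie_fun (tangent_coord _ _ dc).
have := lie_generator s01 ge (mdiff_coord j dc); rewrite /lie_fun => ->.
by apply: eq_bigr => i _; rewrite mulN1r.
Qed.

Let x := chart_coord (chart_at e0).
Let Dd t := \matrix_(a, j) dfun (qd j t) e0 a 0.

Let x_smooth_at a : smooth_at (x a) e0.
Proof. exact: (smooth_at_coord a (smooth_at_cmap (atE e0) (memE e0))). Qed.

(** By the Leibniz rule, the terms in which qd i is not differentiated add
    up to the Jacobi identity for xi i and two coordinates; the brackets of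
    qd i with coordinates remain. *)
Let lie_bivector_generator t : 0 <= t <= 1 ->
  lie_bivector (generator t) (P t) e0 =
  ((A e0)^T *m P t e0)^T *m ((Dd t)^T *m P t e0)
  - ((Dd t)^T *m P t e0)^T *m ((A e0)^T *m P t e0).
Proof.
move=> t01; have [[Po _] _ _ _ _] := hdata t01.
have sP e : (P t e)^T = - P t e by have [[]] := Po.
have mx a : differentiable_at (x a) e0 := smooth_at_mdiff (x_smooth_at a).
have mxi i : differentiable_at (xi i) e0 := smooth_at_mdiff (xi_smooth_at i).
have mb (f g : E -> R) : smooth_at f e0 -> smooth_at g e0 ->
    differentiable_at (bracket (P t) f g) e0.
  move=> sf sg.
  exact: (family_germ_mdiff (atE e0) (memE e0) t01 (bracket_family_germ (atE
    e0) (memE e0) t01 sf sg)).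
have mq i : differentiable_at (qd i t) e0.
  exact: (family_germ_mdiff (atE e0) (memE e0) t01 (qd_family_germ i (atE e0)
    (memE e0) t01)).
have sk f g : bracket (P t) f g e0 = - bracket (P t) g f e0 by exact:
    bracket_skew.
have bA i a : bracket (P t) (xi i) (x a) e0 = ((A e0)^T *m P t e0) i a.
  rewrite /bracket /bivector_at (dfun_projection hpi (mdiff_chart_coord i (atB
    b0) (memB b0))).
  by rewrite !dfun_chart_coord_at trmx_mul trmx_delta -!mulmxA -rowE mulmxA
    -colE !mxE.
have bD i a : bracket (P t) (qd i t) (x a) e0 = ((Dd t)^T *m P t e0) i a.
  rewrite /bracket /bivector_at dfun_chart_coord_at -colE !mxE.
  by apply: eq_bigr => j _; rewrite !mxE.
have lieg a : \forall e \near e0, lie_fun (generator t) (x a) e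
    = \sum_i (- qd i t e) * bracket (P t) (xi i) (x a) e.
  apply: filterS2 near_good (near_cdom (atE e0) (memE e0)) => e ge ce.
  apply: lie_generator => //; exact: (mdiff_chart_coord a (atE e0) ce).
have br1 a b : bracket (P t) (lie_fun (generator t) (x a)) (x b) e0 =
   \sum_i (- qd i t e0 * bracket (P t) (bracket (P t) (xi i) (x a)) (x b) e0
     - ((A e0)^T *m P t e0) i a * ((Dd t)^T *m P t e0) i b).
  rewrite (bracket_near (P t) (lieg a) (g' := x b)); last first.
    by apply: filterS (@filterT _ (nbhs e0) _).
  rewrite bracket_suml; [|by move=> i; exact: mdiffN|by move=> i; exact: mb].
  apply: eq_bigr => i _; rewrite bracketNl // bD mulrN; congr (_ - _ * _).
  exact: bA.
apply/matrixP => a b; rewrite [LHS]mxE -/x.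
rewrite lie_generator //; [|exact: nbhs_singleton near_good|exact: mb].
rewrite br1 [bracket _ (x a) _ _]sk br1 opprK.
rewrite [RHS]mxE [X in _ = X + _]mxE [X in _ = _ + X]mxE [X in _ = _ - X]mxE.
rewrite -sumrB -big_split -sumrB /=; apply: eq_bigr => i _.
have jac := poisson_local Po (xi_smooth_at i) (x_smooth_at a) (x_smooth_at b).
have E1 : bracket (P t) (x a) (bracket (P t) (x b) (xi i)) e0 =
    bracket (P t) (bracket (P t) (xi i) (x b)) (x a) e0.
  rewrite sk -bracketNl; last exact: mb.
  apply: bracket_near; apply: filterS (@filterT _ (nbhs e0) _) => e _ //.
  by rewrite bracket_skew // opprK.
rewrite E1 [bracket _ (x b) _ _]sk in jac.
rewrite ![(_^T) _ _]mxE.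
have -> : bracket (P t) (xi i) (bracket (P t) (x a) (x b)) e0 =
   bracket (P t) (bracket (P t) (xi i) (x a)) (x b) e0
   - bracket (P t) (bracket (P t) (xi i) (x b)) (x a) e0.
  by apply/eqP; rewrite -subr_eq0; apply/eqP; rewrite -jac; ring.
ring.
Qed.

Let Dm s := \matrix_(a, j) dfun (q j s) e0 a 0.
Let K s := gram (P s e0) (A e0).
Let H s := lift (P s e0) (A e0).
Let U := Ups e0.

Let sU : U^T = - U.
Proof. by have [] := coupling_structure hpi e0 (hdata (@unit0 R)). Qed.

Let colDm s i : col i (Dm s) = dfun (q i s) e0.
Proof. by apply/colP => a; rewrite !mxE. Qed.

Let hor_u s i : 0 <= s <= 1 -> hor pi (Gam s) (u i) e0 = row i (H s).
Proof.
move=> s01; have [_ GE _ _ _] := hdata s01.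
have [_ _ uK _ _] := coupling_structure hpi e0 (hdata s01).
by rewrite (hor_lift hpi _ GE uK) u0 -rowE.
Qed.

Let lift_family s : 0 <= s <= 1 -> H s = H 0 + (Dm s)^T *m U.
Proof.
move=> s01; apply/row_matrixP => i.
rewrite -hor_u // hhor // hor_u ?unit0 // linearD /=; congr (_ + _).
by rewrite /sharp -colDm row_mul tr_col.
Qed.

Let q_mdiff s i : 0 <= s <= 1 -> differentiable_at (q i s) e0.
Proof.
move=> s01; exact: (family_germ_mdiff (atE e0) (memE e0) s01
  (eval1_family_germ (atE e0) (memE e0) (vu i) s01)).
Qed.

(** The bracket of u i and u j vanishes at b0, and the wedge bracket is
    twice the skew matrix D^T U D. *)
Let form_family s : 0 <= s <= 1 -> F s e0 =
  F 0 e0 - (H 0 *m Dm s - (H 0 *m Dm s)^T + (Dm s)^T *m U *m Dm s).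
Proof.
move=> s01; apply/matrixP => i j.
have ev r : eval2 pi (F r) (u i) (u j) e0 = F r e0 i j.
  by rewrite /eval2 !u0 trmx_delta -rowE -colE !mxE.
rewrite -ev hF // ev; rewrite [RHS]mxE [X in _ = _ + X]mxE; congr (_ - _).
have lie a b : lie_fun (hor pi (Gam 0) (u a)) (eval1 pi (Q s) (u b)) e0
    = (H 0 *m Dm s) a b.
  rewrite /lie_fun tangent_dfun; last exact: q_mdiff.
  rewrite hor_u ?unit0 // -[dfun _ _]colDm !mxE.
  by apply: eq_bigr => l _; rewrite !mxE.
have ev0 : eval1 pi (Q s) (lie_bracket (u i) (u j)) e0 = 0.
  by rewrite /eval1 bru mul0mx mxE.
pose W := (Dm s)^T *m U *m Dm s.
have br a b : bracket Ups (eval1 pi (Q s) (u a)) (eval1 pi (Q s) (u b)) e0 = W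
    a b.
  rewrite /bracket /bivector_at -!/(q _ s) -!colDm tr_col -row_mul.
  rewrite /W [LHS]mxE [RHS]mxE; apply: eq_bigr => l _.
  by rewrite [row _ _ _ _]mxE [col _ _ _ _]mxE.
have WT : W j i = - W i j.
  have : W^T = - W by rewrite /W !trmx_mul trmxK sU mulNmx mulmxN mulmxA.
  by move=> /(congr1 (fun X : 'M[R]_m => X i j)); rewrite !mxE.
rewrite /covd1 /wedge_bracket !lie ev0 subr0 !br WT.
rewrite -/W [RHS]mxE [X in _ = X + _]mxE [X in _ = _ + X + _]mxE.
rewrite [X in _ = _ - X + _]mxE; congr (_ + _).
by field.
Qed.

Let tder_Dm t : 0 <= t <= 1 -> is_time_derive Dm t (Dd t).
Proof.
move=> t01; apply: tder_mx => a j.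
have H1 := @family_germ_tder_derive R n E _ (q j) t e0 (delta_mx 0 a) (atE e0)
    (memE e0) t01
  (eval1_family_germ (atE e0) (memE e0) (vu j) t01).
have -> : Dd t a j = tangent_fun (qd j t) e0 (delta_mx 0 a) by rewrite !mxE.
by apply: (tder_eq t01 _ H1) => s _; rewrite !mxE.
Qed.

Let tder_P t : 0 <= t <= 1 ->
  is_time_derive (fun s => P s e0) t (time_derive (fun s => P s e0) t).
Proof.
move=> t01; have : is_time_derive (fun s => P s e0) t
    (\matrix_(a, b) time_derive (fun s => bracket (P s) (x a) (x b) e0) t).
  apply: tder_mx => a b; rewrite mxE.
  have := family_germ_tder (atE e0) (memE e0) t01
    (bracket_family_germ (atE e0) (memE e0) t01 (x_smooth_at a) (x_smooth_at
      b)).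
  apply: tder_eq => // s _; exact: bracket_chart_coord_at.
by move=> h; rewrite (tder_lim t01 h).
Qed.

(** The relations P = Ups + H^T K H and K F K = - K hold at every time, so
    their time derivatives give the hypotheses of generator_algebra. *)
Lemma generator_invariance t : 0 <= t <= 1 ->
  lie_bivector (generator t) (P t) e0 + time_derive (fun s => P s e0) t = 0.
Proof.
move=> t01; rewrite lie_bivector_generator //.
set Pd := time_derive _ _;
  have dP : is_time_derive (fun s => P s e0) t Pd := tder_P t01.
have dD := tder_Dm t01; have dDT := tder_tr dD.
have [sP _ uK KFK PE] := coupling_structure hpi e0 (hdata t01).
have dK : is_time_derive K t (gram Pd (A e0)).
  have := tder_mulmx (tder_mulmx (tder_cst (A e0)^T t) dP) (tder_cst (A e0) t).
  by rewrite mul0mx add0r mulmx0 addr0.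
have dH : is_time_derive H t ((Dd t)^T *m U).
  apply: (tder_eq t01 (g := fun s => H 0 + (Dm s)^T *m U)).
    by move=> s s01; rewrite (lift_family s01).
  have := tderD (tder_cst (H 0) t) (tder_mulmx dDT (tder_cst U t)).
  by rewrite add0r mulmx0 addr0.
have dF : is_time_derive (fun s =>
    F s e0) t (- (H t *m Dd t - (H t *m Dd t)^T)).
  apply: (tder_eq t01 (g := fun s => F 0 e0
      + - (H 0 *m Dm s + - (H 0 *m Dm s)^T + (Dm s)^T *m U *m Dm s))).
    by move=> s s01; rewrite (form_family s01).
  have d1 := tder_mulmx (tder_cst (H 0) t) dD.
  have d2 := tder_mulmx (tder_mulmx dDT (tder_cst U t)) dD.
  have := tderD (tder_cst (F 0 e0) t) (tderN (tderD (tderD d1 (tderN (tder_tr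
      d1))) d2)).
  (* The two mixed terms replace the initial connection H 0 by H t. *)
  have HD : H t *m Dd t = H 0 *m Dd t + (Dm t)^T *m U *m Dd t.
    by rewrite (lift_family t01) mulmxDl.
  have HDT : (H t *m Dd t)^T = (H 0 *m Dd t)^T - (Dd t)^T *m U *m Dm t.
    rewrite HD linearD /=; congr (_ + _).
    by rewrite !trmx_mul trmxK sU mulNmx mulmxN mulmxA.
  rewrite HDT HD mul0mx !add0r mulmx0 addr0; congr (is_time_derive _ _ _).
  move: (H 0 *m Dd t) ((Dm t)^T *m U *m Dd t) ((Dd t)^T *m U *m Dm t) => X Y Z.
  by apply/matrixP => i j; rewrite !mxE; ring.
have PdE : Pd = (((Dd t)^T *m U)^T *m K t + (H t)^T *m gram Pd (A e0)) *m H t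
    + (H t)^T *m K t *m ((Dd t)^T *m U).
  apply: (tder_unique t01 dP).
  apply: (tder_eq t01 (g := fun s => U + (H s)^T *m K s *m H s)).
    move=> s s01; symmetry.
    by have [_ _ _ _] := coupling_structure hpi e0 (hdata s01).
  have := tderD (tder_cst U t) (tder_mulmx (tder_mulmx (tder_tr dH) dK) dH).
  by rewrite add0r.
have KdE : (gram Pd (A e0) *m F t e0 + K t *m (- (H t *m Dd t - (H t *m Dd
    t)^T))) *m K t
    + K t *m F t e0 *m gram Pd (A e0) = - gram Pd (A e0).
  have dKFK := tder_mulmx (tder_mulmx dK dF) dK.
  apply: (tder_unique t01 dKFK).
  apply: (tder_eq t01 (g := fun s => - K s)); last exact: tderN.
  move=> s s01; symmetry.
  by have [] := coupling_structure hpi e0 (hdata s01).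
exact: (generator_algebra sP sU (gram_skew (A e0) sP) uK (mulmx_gram_lift uK)
  KFK PE
  PdE KdE erefl erefl).
Qed.

End AtPoint.

Lemma generator_time_dependent : time_dependent_vector_field generator.
Proof.
move=> c ac c' ac' [t y] [/= t01 [e [c'e ce] <-]].
have {}t01 : 0 <= t <= 1 by move: t01; rewrite in_itv.
have [u [vu u0 lieu bru]] := coordinate_fields (pi e).
have := @generator_family_germ e u vu lieu c c' t ac ac' ce c'e t01.
apply: smooth_germ_eq => -[s z] [/= s01 [e' [c'e' ce'] <-]]; split => //.
by split => //; exact: image_cmap.
Qed.

End Generator.

Theorem theorem2p18 (R : realType) (n m k : nat)
  (E : manifold R n) (B : manifold R m) (Fib : manifold R k) (pi : E -> B)
  (hpi : fiber_bundle Fib pi)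
  (P : R -> E -> 'M[R]_n) (Ups : E -> 'M[R]_n)
  (Gam : R -> E -> set 'rV[R]_n) (F : R -> E -> 'M[R]_m)
  (hP : smooth_bivector_family P)
  (hdata : forall t : R, 0 <= t <= 1 ->
     geometric_data pi (P t) Ups (Gam t) (F t))
  (Q : R -> E -> 'cV[R]_m)
  (hQ : smooth_form1_family pi Q)
  (hhor : forall t : R, 0 <= t <= 1 ->
     forall u : B -> 'rV[R]_m, vector_field u -> forall e : E,
       hor pi (Gam t) u e
       = hor pi (Gam 0) u e + sharp (Ups e) (dfun (eval1 pi (Q t) u) e))
  (hF : forall t : R, 0 <= t <= 1 ->
     forall u0 u1 : B -> 'rV[R]_m, vector_field u0 -> vector_field u1 ->
     forall e : E,
       eval2 pi (F t) u0 u1 e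
       = eval2 pi (F 0) u0 u1 e
         - (covd1 pi (Gam 0) (Q t) u0 u1 e
            + 2^-1 * wedge_bracket pi Ups (Q t) u0 u1 e)) :
  exists X : R -> E -> 'rV[R]_n,
    [/\ time_dependent_vector_field X,
        (forall t : R, 0 <= t <= 1 -> forall e : E,
           Gam t e (X t e) /\
           interior_product pi (X t) (F t) e = time_derive (fun s => Q s e) t),
        (forall (t : R) (Y : E -> 'rV[R]_n), 0 <= t <= 1 ->
           (forall e : E,
              Gam t e (Y e) /\
              interior_product pi Y (F t) e = time_derive (fun s => Q s e) t) ->
           forall e : E, Y e = X t e) &
        infinitesimal_generator X P].
Proof.
have smoothX := generator_time_dependent hpi hP hQ.
exists (generator pi P Q); split => //.
- move=> t t01 e; exact: (generator_horizontal hpi hdata Q e t01).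
- move=> t Y t01 hY; exact: (generator_unique hpi hdata t01 hY).
- split=> // t t01 e.
  have [u [vu u0 lieu bru]] := coordinate_fields (pi e).
  exact: (generator_invariance hpi hP hdata hQ hhor hF vu u0 lieu bru t01).
Qed.
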